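(* Assume that $g$ is an increasing, concave function with $g(0)=0$, $g(1)=1$ and $g(r)>r$ for $r\in(0,1)$, and that $\frac q2\frac{V(t)}{s_m(t)}<\overline e$ for all $t\in(0,T_* )$. Let $\underline T$ (respectively $\overline T$) be the minimal (respectively maximal) time necessary to reach the point $(r,n)=(1,\underline n)$ using an admissible control $e(\cdot)$. Then: (i) if $\underline T$ is finite and $g(r)=r^{1-\theta}$ with $0<\theta<1$, the trajectory that reaches the point $(r,n)=(1,\underline n)$ in the minimal time $\underline T$ is the trajectory $E_0$; (ii) if $\overline T$ is finite, the trajectory that reaches the point $(r,n)=(1,\underline n)$ in the maximal time $\overline T$ is the trajectory $E^0$, and $\overline T$ is the solution of $$\underline n^{1-\frac2q}-n(0)^{1-\frac2q}=A^{\frac2q}\Big(1-\frac q2\Big)\int_{t^0}^{\overline T}V(u)\,du .$$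
   Context: Forest model. Fixed data: $0<A<1$, $1<q<2$, $\underline n>0$, $\overline e>0$, $T_*>0$, a function $V:[0,T_*]\to(0,\infty)$ and a function $g:J\to\mathbb R$, where $J\subset[0,\infty)$ is an interval containing $[0,1]$ (and $J=[0,\infty)$ when $g(r)=r^{1-\theta}$). $g$ and $V$ are regular enough ($g$ continuous on $J$ and $C^2$ on $J\setminus\{0\}$, $V$ continuous) for the system below to have a unique solution for each control and initial condition. The relative density index is $r(n,s)=A\,n\,s^{q/2}$. The state (basal area $s$, tree number $n$), controlled by the measurable thinning rate $e(\cdot)$, satisfies $$\frac{ds}{dt}=\frac{g(r(n(t),s(t)))}{n(t)}V(t),\qquad \frac{dn}{dt}=-e(t),$$ with fixed initial condition $s(0)>0$, $n(0)\ge\underline n$, $r(n(0),s(0))<1$. A control is admissible on $[0,T]$ if $0\le e(t)\le\overline e$, $n(t)\ge\underline n$ and $r(n(t),s(t))\le1$ for all $t\in[0,T]$. $s_m(t)$ is the minimal value that $s(t)$ can take at time $t$ over all controls admissible on $[0,t]$ (the condition involving $s_m$ is imposed for those $t$ for which such controls exist). Put $e_r(s,t)=\frac q2\frac{V(t)}{s}$. $\underline T$ (resp. $\overline T$) is the minimum (resp. maximum) of the times $T\in(0,T_*]$ for which there is a control admissible on $[0,T]$ with $r(n(T),s(T))=1$ and $n(T)=\underline n$. ''$\underline T$ is finite'' means that at least one such $T$ exists; ''$\overline T$ is finite'' means that the maximum exists, $\overline T<T_*$, and no control is admissible on $[0,T]$ for $\overline T<T\le T_*$. Trajectory $E_0$: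 with $t_{0,\underline n}=(n(0)-\underline n)/\overline e$, the control is $e(t)=\overline e$ for $t<t_{0,\underline n}$ and $e(t)=0$ for $t>t_{0,\underline n}$. Trajectory $E^0$: the control is $e(t)=0$ as long as $r(n(t),s(t))<1$, i.e. for $t<t^0$, where $t^0$ is the first time at which $r=1$; then $e(t)=e_r(s(t),t)$ (which keeps $r=1$) for $t^0<t<T^0$, where $T^0$ is the time at which $n=\underline n$. *)

(* Defs.v *)
From mathcomp Require Import all_boot all_order all_algebra.
From mathcomp Require Import all_classical all_reals all_analysis.

Set Implicit Arguments.
Unset Strict Implicit.
Unset Printing Implicit Defensive.

Import Order.TTheory GRing.Theory Num.Theory.
Import numFieldNormedType.Exports.
Local Open Scope classical_set_scope.
Local Open Scope ring_scope.

Definition is_min {R : realType} (S : set R) (m : R) : Prop := S m /\ lbound S m.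

Definition is_max {R : realType} (S : set R) (m : R) : Prop := S m /\ ubound S m.

Definition concave_on {R : realType} (D : set R) (f : R -> R) : Prop :=
  @convex_function R R^o D (fun x => - f x).

(* [f'] is the derivative of [f] relative to [D]: it is one-sided at an
   endpoint of the interval that belongs to [D]. *)
Definition derivative_within {R : realType} (D : set R) (f f' : R -> R) : Prop :=
  forall x, D x ->
    (fun y => (f y - f x) / (y - x)) @ within D (dnbhs x) --> f' x.

Definition C2_on {R : realType} (D : set R) (f : R -> R) : Prop :=
  exists f1 f2 : R -> R,
    [/\ derivative_within D f f1,
        derivative_within D f1 f2 &
        {within D, continuous f2}].

(* [g] and [V] are total functions, but only their values on [J] and on
   [0, Tstar] are ever used. *)
Record forest (R : realType) := Forest {
  coefA : R;
  expq : R;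
  nmin : R;
  emax : R;
  Tstar : R;
  V : R -> R;
  J : set R;
  g : R -> R;
  s0 : R;
  n0 : R
}.

Section Model.
Context {R : realType} (M : forest R).

Notation mu := (@lebesgue_measure R).

Definition density (n s : R) : R := coefA M * n * s `^ (expq M / 2).

Record standing : Prop := Standing {
  coefA_range : 0 < coefA M < 1;
  expq_range : 1 < expq M < 2;
  nmin_gt0 : 0 < nmin M;
  emax_gt0 : 0 < emax M;
  Tstar_gt0 : 0 < Tstar M;
  V_gt0 : {in `[0, Tstar M], forall t, 0 < V M t};
  V_continuous : {within `[0, Tstar M], continuous (V M)};
  J_interval : is_interval (J M);
  J_ge0 : J M `<=` `[0, +oo[;
  J_unit : `[0, 1] `<=` J M;
  g_continuous : {within J M, continuous (g M)};
  g_C2 : C2_on (J M `\ 0) (g M);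
  s0_gt0 : 0 < s0 M;
  n0_ge : nmin M <= n0 M;
  density0_lt1 : density (n0 M) (s0 M) < 1
}.

Definition growth (n s : R -> R) (t : R) : R :=
  g M (density (n t) (s t)) / n t * V M t.

(* Controls are only measurable, so the system is read in the sense of
   Caratheodory: the state is the integral of the right-hand side. *)
Record solution (T : R) (e s n : R -> R) : Prop := Solution {
  control_measurable : measurable_fun `[0, T] e;
  control_integrable : mu.-integrable `[0, T] (EFin \o e);
  growth_integrable : mu.-integrable `[0, T] (EFin \o growth n s);
  density_dom : {in `[0, T], forall t, density (n t) (s t) \in J M};
  s_eq : {in `[0, T], forall t,
    s t = s0 M + \int[mu]_(u in `[0, t]) growth n s u};
  n_eq : {in `[0, T], forall t, n t = n0 M - \int[mu]_(u in `[0, t]) e u}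
}.

Definition admissible (T : R) (e s n : R -> R) : Prop :=
  solution T e s n /\
  {in `[0, T], forall t,
    [/\ 0 <= e t <= emax M, nmin M <= n t & density (n t) (s t) <= 1]}.

Definition attainable_s (t : R) : set R :=
  [set x | exists e s n, admissible t e s n /\ s t = x].

(* [is_sm t m] : m = s_m(t), for the times t at which s_m(t) is defined. *)
Definition is_sm (t m : R) : Prop := is_min (attainable_s t) m.

Definition e_r (s t : R) : R := expq M / 2 * (V M t / s).

Definition reaches (T : R) (e s n : R -> R) : Prop :=
  [/\ admissible T e s n, density (n T) (s T) = 1 & n T = nmin M].

Definition reach_times : set R :=
  [set T | 0 < T <= Tstar M /\ exists e s n, reaches T e s n].

(* Controls are identified when they agree almost everywhere. *)
Definition same_trajectory (T : R) (e s n e' s' n' : R -> R) : Prop :=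
  {ae mu, forall t, t \in `[0, T] -> e' t = e t} /\
  {in `[0, T], forall t, s' t = s t /\ n' t = n t}.

(* (e, s, n) is the only trajectory reaching (r, n) = (1, nmin) at time T. *)
Definition only_trajectory_reaching (T : R) (e s n : R -> R) : Prop :=
  reaches T e s n /\
  forall e' s' n', reaches T e' s' n' -> same_trajectory T e s n e' s' n'.

Definition t0_nmin : R := (n0 M - nmin M) / emax M.

(* The trajectory $E_0$ on [0, T]. *)
Definition traj_E_sub0 (T : R) (e s n : R -> R) : Prop :=
  [/\ solution T e s n,
      {in `[0, T], forall t, t < t0_nmin -> e t = emax M} &
      {in `[0, T], forall t, t0_nmin < t -> e t = 0}].

(* The trajectory $E^0$; [t0] and [T0] stand for $t^0$ and $T^0$. *)
Record traj_E_sup0 (t0 T0 : R) (e s n : R -> R) : Prop := TrajEsup0 {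
  E0_solution : solution T0 e s n;
  E0_t0_range : 0 <= t0 <= T0;
  E0_before : {in `[0, t0[, forall t, density (n t) (s t) < 1};
  E0_at_t0 : density (n t0) (s t0) = 1;
  E0_phase1 : {in `[0, t0[, forall t, e t = 0};
  E0_phase2 : {in `]t0, T0[, forall t, e t = e_r (s t) t};
  E0_above : {in `[t0, T0[, forall t, nmin M < n t};
  E0_end : n T0 = nmin M
}.

End Model.

(* Main.v *)
Require Import Defs.
From mathcomp Require Import all_boot all_order all_algebra.
From mathcomp Require Import all_classical all_reals all_analysis.
From mathcomp Require Import measurable_realfun ring lra.
Import Order.TTheory GRing.Theory Num.Theory.
Import numFieldNormedType.Exports.
Local Open Scope classical_set_scope.
Local Open Scope ring_scope.

(** Why the theorem holds.

    Write [a = q/2], so that [r = A n s^a]. As [g] is concave with [g 0 = 0], the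
    quotient [g r / r] does not increase; hence at a given basal area [s] the
    growth [g r / n * V] decreases with the tree number [n].

    Slowest growth. At basal area [s] the tree number is at most the smaller
    of [n(0)] and the number making [r = 1]. This gives a lower bound
    [slow_rate s * V t] for [ds/dt] ([slow_rate_min]), and the equation with this
    bound as right-hand side is separable: its solution satisfies
    [area_clock (s t) = time_clock t]. Along every admissible trajectory
    [area_clock (s t) >= time_clock t] ([adm_clock_le]), while E^0 attains equality.
    So [s_m] is the basal area of E^0, provided that E^0 is admissible, which by
    a continuation argument follows from the hypothesis on [s_m]
    ([slow_e_r_lt]).

    Maximal time. Reaching [(r, n) = (1, nmin)] means that [s] takes the value
    [full_area nmin], the largest possible one. A trajectory doing so at time [T]
    has [time_clock T <= area_clock (full_area nmin)], and equality holds for E^0.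
    As E^0 stays admissible until then, the maximal time is the one where both
    clocks agree, and equality of the clocks at the end forces equality
    everywhere ([slow_only]). In the second phase [slow_rate x = A x^a], so
    that [area_clock] is explicit there ([area_clock_full]).

    Minimal time. For [g r = r^(1-theta)] a suitable power of [s] is an explicit
    integral of [n^(-theta) V] ([fast_gap]). Since [n] is at least the tree number
    of E_0, the basal area is at most that of E_0 ([adm_le_fast_area]), with
    equality only for E_0 ([adm_fast_unique]). When some trajectory reaches the
    target, E_0 has therefore already reached density index 1, and the first time
    at which it does so is minimal. It remains to see that E_0 does not reach
    [r = 1] while it is still cutting: there the derivative of [r] has the sign of
    [e_r - emax], which is negative because [s >= s_m] ([fast_turning_point]). *)

Set Implicit Arguments.
Unset Strict Implicit.
Unset Printing Implicit Defensive.

(** * Extending functions beyond an interval *)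

Section Clamp.
Context {R : realType}.
Implicit Types (a b x : R) (f : R -> R).

(** The data [V], [g] and the trajectories are known on a segment only.
    Freezing a function at its end values outside the segment makes it
    continuous on the whole line, so that its antiderivative is differentiable
    at the end points too and no one-sided derivative ever appears. *)
Definition clamp a b x := Num.max a (Num.min b x).

Lemma clamp_itv a b x : a <= b -> a <= clamp a b x <= b.
Proof. by move=> ab; rewrite /clamp le_max lexx ge_max ab ge_min lexx. Qed.

Lemma clamp_id a b x : a <= x <= b -> clamp a b x = x.
Proof. by case/andP=> ax xb; rewrite /clamp (min_idPr xb) (max_idPr ax). Qed.

Lemma continuous_clamp a b : continuous (clamp a b).
Proof.
move=> x; have cm : {for x, continuous (fun z : R => Num.min b z)}.
  by apply: (@continuous_min _ R (cst b) id); [exact: cvg_cst|exact: cvg_id].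
by apply: (@continuous_max _ R (cst a)); [exact: cvg_cst|exact: cm].
Qed.

Lemma continuous_comp_clamp a b f : a <= b ->
  {within `[a, b], continuous f} -> continuous (f \o clamp a b).
Proof.
move=> ab /subspace_continuousP cf x.
have cab : `[a, b]%classic (clamp a b x) by rewrite /= in_itv /= clamp_itv.
apply: (@cvg_comp _ _ _ (clamp a b) f _ _ _ _ (cf _ cab)) => A /=.
rewrite /within /= => /(@continuous_clamp a b x) wA.
have {}wA : \forall y \near x, clamp a b y \in `[a, b] -> A (clamp a b y) := wA.
apply: (@filterS _ (nbhs x) _ _ _ _ wA) => y; apply; rewrite in_itv /= clamp_itv //.
Qed.

End Clamp.
(** * Derivatives and antiderivatives on the line *)

Section Calculus.
Context {R : realType}.
Notation mu := (@lebesgue_measure R).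
Implicit Types (a b x : R) (f F : R -> R).

Lemma is_derive_continuous f x d : is_derive x 1 f d -> {for x, continuous f}.
Proof.
by move=> h; apply/differentiable_continuous/derivable1_diffP; case: h.
Qed.

Lemma derive_within_continuous a b f (df : R -> R) :
  (forall x, a <= x <= b -> is_derive x 1 f (df x)) ->
  {within `[a, b], continuous f}.
Proof.
move=> dff; apply: derivable_within_continuous => x.
by rewrite in_itv /= => /dff [].
Qed.

Lemma continuous_integrable a b f : {within `[a, b], continuous f} ->
  mu.-integrable `[a, b] (EFin \o f).
Proof. by apply: continuous_compact_integrable; exact: segment_compact. Qed.

Lemma integral_derive a b f F : a <= b -> {within `[a, b], continuous f} ->
  (forall x, a <= x <= b -> is_derive x 1 F (f x)) ->
  \int[mu]_(x in `[a, b]) f x = F b - F a.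
Proof.
rewrite le_eqVlt => /predU1P[<- _ _|ab cf dF].
  by rewrite set_itv1 Rintegral_set1 subrr.
rewrite /Rintegral (@continuous_FTC2 _ f F) //.
  split.
  - by move=> x /= /andP[ax xb]; case: (dF x _); rewrite // !ltW.
  - apply: cvg_at_right_filter; apply: (is_derive_continuous (dF a _)).
    by rewrite lexx ltW.
  - apply: cvg_at_left_filter; apply: (is_derive_continuous (dF b _)).
    by rewrite lexx ltW.
move=> x; rewrite in_itv /= => /andP[ax xb].
by rewrite derive1E; case: (dF x _) => //; rewrite !ltW.
Qed.

(** At most one of the two integrals over [[a, x]] and [[x, a]] is nonzero;
    their difference is the oriented integral, and on each half line
    [x > b] it differs by a constant from the integral over [[b, x]]. *)
Lemma continuous_antiderivative a f : continuous f ->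
  exists F, F a = 0 /\ forall x, is_derive x 1 F (f x).
Proof.
move=> cf.
have cw u v : {within `[u, v], continuous f} by exact: continuous_subspaceT.
pose F x := \int[mu]_(t in `[a, x]) f t - \int[mu]_(t in `[x, a]) f t.
exists F; split; first by rewrite /F subrr.
move=> x; (* A base point to the left of both [x] and [a]. *)
pose b := Num.min x a - 1.
have bx : b < x by rewrite /b; case: (leP x a); lra.
have ba : b < a by rewrite /b; case: (leP x a); lra.
pose G z := \int[mu]_(t in `[b, z]) f t - \int[mu]_(t in `[b, a]) f t.
have split u v : b <= u -> u <= v -> \int[mu]_(t in `[b, v]) f t -
     \int[mu]_(t in `[b, u]) f t = \int[mu]_(t in `[u, v]) f t.
  move=> bu uv; rewrite Rintegral_itvB ?bnd_simp//; last exact: continuous_integrable.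
  rewrite Rintegral_itv_obnd_cbnd//.
  by apply: (integrableS _ _ _ (continuous_integrable (cw u v))) => //; exact: subset_itv_oc_cc.
have FG z : b < z -> F z = G z.
  move=> bz; rewrite /F /G; case: (ltgtP a z) => az.
  - rewrite (split a z) ?ltW// [in X in _ - X = _]set_itv_ge.
      by rewrite Rintegral_set0 subr0.
    by rewrite bnd_simp -ltNge.
  - rewrite -[RHS]opprB (split z a) ?ltW// [in X in X - _ = _]set_itv_ge.
      by rewrite Rintegral_set0 sub0r.
    by rewrite bnd_simp -ltNge.
  - by rewrite az !subrr.
have [dG G'] := @continuous_FTC1 R f (BLeft b) x (x + 1) (ltac:(lra))
  (continuous_integrable (cw _ _)) ltac:(by rewrite /Order.lt /= bx) (cf x).
have dG1 : is_derive x 1 G (f x).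
  rewrite -[f x]subr0 /G; apply: is_deriveB.
  by split => //; rewrite -G' derive1E.
apply: (@near_eq_is_derive _ _ _ G) => //.
near=> z; rewrite FG//; near: z; exact: lt_nbhsr.
Unshelve. all: by end_near. Qed.

Definition primitive a f : R -> R :=
  xget (cst 0) [set F | F a = 0 /\ forall x : R, is_derive x 1 F (f x)].

Lemma primitiveP a f : continuous f -> primitive a f a = 0 /\
  forall x : R, is_derive x 1 (primitive a f) (f x).
Proof.
move=> /(continuous_antiderivative a)[F Ff].
by rewrite /primitive; case: xgetP => [G _|/(_ F)].
Qed.

Lemma derive_ge0_le a b f (df : R -> R) : a <= b ->
  (forall x, a <= x <= b -> is_derive x 1 f (df x)) ->
  (forall x, a < x < b -> 0 <= df x) -> f a <= f b.
Proof.
move=> ab dff df0.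
have oc x : a < x < b -> a <= x <= b by case/andP=> ? ?; rewrite !ltW.
apply: (@ger0_derive1_le_cc _ f a b) => //.
- by move=> x; rewrite in_itv /= => /oc /dff [].
- move=> x; rewrite in_itv /= => xab; rewrite derive1E.
  by case: (dff x (oc _ xab)) => _ ->; exact: df0.
- exact: derive_within_continuous dff.
- by rewrite in_itv /= lexx ab.
- by rewrite in_itv /= lexx ab.
Qed.

(** Such a function is squeezed between its equal end values. This is how the
    equality cases of all comparisons below are exploited. *)
Lemma derive_ge0_const a b f (df : R -> R) : f a = f b ->
  (forall x, a <= x <= b -> is_derive x 1 f (df x)) ->
  (forall x, a < x < b -> 0 <= df x) ->
  (forall x, a <= x <= b -> f x = f a) /\ (forall x, a < x < b -> df x = 0).
Proof.
move=> fab dff df0.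
have fc x : a <= x <= b -> f x = f a.
  move=> /andP[ax xb]; apply/eqP; rewrite eq_le; apply/andP; split.
    rewrite fab; apply: (@derive_ge0_le x b f df) => // z /andP[h1 h2].
    + by apply: dff; rewrite (le_trans ax h1).
    + by apply: df0; rewrite (le_lt_trans ax h1).
  apply: (@derive_ge0_le a x f df) => // z /andP[h1 h2].
  + by apply: dff; rewrite (le_trans h2 xb) h1.
  + by apply: df0; rewrite (lt_le_trans h2 xb) h1.
split=> // x /andP[ax xb].
have h1 : is_derive x 1 f (df x) by apply: dff; rewrite !ltW.
have h2 : is_derive x 1 f 0.
  apply: (@near_eq_is_derive _ _ _ (cst (f a))).
  near=> z; rewrite /cst fc//; apply/andP; split; apply: ltW.
  - by near: z; exact: lt_nbhsr.
  - by near: z; exact: lt_nbhsl.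
by case: h1 => _ <-; case: h2.
Unshelve. all: by end_near. Qed.

Lemma derive_gt0_lt a b f (df : R -> R) : a < b ->
  (forall x, a <= x <= b -> is_derive x 1 f (df x)) ->
  (forall x, a < x < b -> 0 < df x) -> f a < f b.
Proof.
move=> ab dff df0; rewrite lt_neqAle; apply/andP; split; last first.
  by apply: (derive_ge0_le (ltW ab) dff) => x /df0 /ltW.
apply/eqP => fab.
have df0' x : a < x < b -> 0 <= df x by move=> /df0 /ltW.
have m : a < (a + b) / 2 < b by lra.
have [_ /(_ _ m) e] := derive_ge0_const fab dff df0'.
by have := df0 _ m; rewrite e ltxx.
Qed.

Lemma derive_0_eq a b f (df : R -> R) : a <= b ->
  (forall x, a <= x <= b -> is_derive x 1 f (df x)) ->
  (forall x, a < x < b -> df x = 0) -> f a = f b.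
Proof.
move=> ab dff df0; apply/eqP; rewrite eq_le; apply/andP; split.
  by apply: (derive_ge0_le ab dff) => x /df0 ->.
rewrite -lerN2; apply: (@derive_ge0_le a b (- f) (- df) ab).
  by move=> x /dff h; exact: is_deriveN.
by move=> x /df0 h; rewrite opprfctE h oppr0.
Qed.

Lemma IVT_le a b f v : a <= b -> continuous f -> f a <= v <= f b ->
  exists2 c, a <= c <= b & f c = v.
Proof.
move=> ab cf /andP[av vb].
have cw : {within `[a, b], continuous f} by exact: continuous_subspaceT.
have := @IVT _ f a b v ab cw.
have -> : Num.min (f a) (f b) = f a by apply/min_idPl/(le_trans av vb).
have -> : Num.max (f a) (f b) = f b by apply/max_idPr/(le_trans av vb).
by rewrite av vb => /(_ isT) [c]; rewrite in_itv /= => ? ?; exists c.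
Qed.

(** If the derivative were negative, the values just before [x] would exceed
    the value at [x]. *)
Lemma derive_left_max f x b d :
  is_derive x 1 f d -> b < x -> (forall u, b <= u < x -> f u <= f x) -> 0 <= d.
Proof.
move=> [df <-] bx fmax; rewrite leNgt; apply/negP => d0.
have /(cvgr_lt ('D_1 f x)) /(_ 0 d0) := df.
rewrite near_withinE => /nbhs_ballP[e /= e0 be].
pose k := Num.min (e / 2) (x - b).
have k0 : 0 < k by rewrite lt_min subr_gt0 bx divr_gt0.
have ke : k < e by rewrite (@le_lt_trans _ _ (e / 2)) ?ge_min ?lexx//; lra.
have kb : k <= x - b by rewrite ge_min lexx orbT.
have := be (- k); rewrite /ball /= sub0r opprK gtr0_norm// oppr_eq0 gt_eqF//.
move=> /(_ ke isT); rewrite /GRing.scale /= mulr1 invrN mulNr oppr_lt0.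
rewrite pmulr_rgt0 ?invr_gt0// subr_gt0 ltNge => /negP; apply.
by apply: fmax; rewrite addrC; lra.
Qed.

Definition inverse f y : R := xget 0 [set x | f x = y].

(** A slope bounded below by a positive constant forces the function to be
    unbounded on both sides, hence onto by the intermediate value theorem. *)
Lemma derive_bounded_below_inverse f (df : R -> R) (c : R) : 0 < c ->
  (forall x, is_derive x 1 f (df x)) -> (forall x, c <= df x) ->
  [/\ cancel f (inverse f), cancel (inverse f) f &
    forall y : R, is_derive y 1 (inverse f) (df (inverse f y))^-1].
Proof.
move=> c0 dff cdf.
have cf : continuous f by move=> x; exact: is_derive_continuous (dff x).
have df0 x : 0 < df x by exact: lt_le_trans c0 (cdf x).
have flt x y : x < y -> f x < f y by move=> xy; apply: (@derive_gt0_lt x y f df).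
have finj : injective f.
  move=> x y fxy; case: (ltgtP x y) => // xy; have := flt _ _ xy;
  by rewrite fxy ltxx.
have fgrow x y : x <= y -> c * (y - x) <= f y - f x.
  move=> xy; have := @derive_ge0_le x y (fun z => f z - c * z) (fun z => df z - c) xy.
  have dd z : x <= z <= y -> is_derive z 1 (fun z => f z - c * z) (df z - c).
    move=> _; apply: is_deriveB.
    by apply: is_derive_eq; rewrite scaler1.
  move=> /(_ dd); rewrite -subr_ge0 => /(_ _)/le_trans h.
  have h1 : f x - c * x <= f y - c * y.
    apply: (@derive_ge0_le x y _ (fun z => df z - c) xy dd) => z _.
    by rewrite subr_ge0.
  lra.
have fsur y : exists x, f x = y.
  (* The values of [f] at [- L] and [L] lie on either side of [y]. *)
  pose L := `|y - f 0| / c.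
  have L0 : 0 <= L by rewrite divr_ge0// ltW.
  have cL : c * L = `|y - f 0| by rewrite /L mulrC divfK// gt_eqF.
  have [] := @IVT_le (- L) L f y _ cf; first lra.
    have := fgrow 0 L L0; have := @fgrow (- L) 0; rewrite oppr_le0 => /(_ L0).
    rewrite subr0 opprK add0r cL.
    have := ler_norm (y - f 0); have := ler_norm (- (y - f 0)); rewrite normrN.
    lra.
  by move=> x _ fx; exists x.
have hK : cancel (inverse f) f.
  move=> y; rewrite /inverse; case: xgetP => // ne.
  by have [x fx] := fsur y; have := ne x.
have fK : cancel f (inverse f) by move=> x; apply: finj; rewrite hK.
split => // y.
rewrite -{1}[y]hK; apply: is_derive_inverse => //.
- by near=> z; exact: fK.
- by near=> z; exact: cf.
- by rewrite gt_eqF.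
Unshelve. all: by end_near. Qed.

(** The infimum of the times at which [f] is nonpositive is attained, because
    [f] is continuous. *)
Lemma first_nonpos a b f : continuous f -> a <= b -> f b <= 0 ->
  exists t, [/\ a <= t <= b, f t <= 0 & forall u, a <= u < t -> 0 < f u].
Proof.
move=> cf ab fb.
pose B := [set t | a <= t <= b /\ f t <= 0].
have B0 : B !=set0 by exists b; rewrite /B /= ab lexx.
have lB : has_lbound B by exists a => t [/andP[]].
have hB : has_inf B by split.
exists (inf B).
have aB : a <= inf B by apply: lb_le_inf => // t [/andP[]].
have Bb : inf B <= b by apply: ge_inf => //; rewrite /B /= ab lexx.
have before u : a <= u < inf B -> 0 < f u.
  move=> /andP[au uB]; rewrite ltNge; apply/negP => fu.
  suff : inf B <= u by rewrite leNgt uB.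
  by apply: ge_inf => //; split => //; rewrite au (le_trans (ltW uB) Bb).
split=> //; first by rewrite aB Bb.
rewrite leNgt; apply/negP => fp.
have : \forall z \near inf B, 0 < f z.
  by apply: (cvgr_gt (f (inf B)) (cf (inf B))).
move=> /nbhs_ballP [e /= e0 be].
have [t [tab ft] tB] := inf_adherent e0 hB.
have : 0 < f t.
  apply: be; rewrite /ball /= distrC ger0_norm ?ltrBlDl// subr_ge0.
  by apply: ge_inf.
by rewrite ltNge ft.
Qed.

Lemma first_zero a b f : continuous f -> a <= b -> 0 < f a -> f b <= 0 ->
  exists t, [/\ a < t <= b, f t = 0 & forall u, a <= u < t -> 0 < f u].
Proof.
move=> cf ab fa fb; have [t [/andP[at_ tb] ft before]] := first_nonpos cf ab fb.
have lat : a < t.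
  by rewrite lt_neqAle at_ andbT; apply/eqP => e; move: ft; rewrite -e leNgt fa.
exists t; split => //; first by rewrite lat tb.
apply/eqP; rewrite eq_le ft leNgt; apply/negP => ft0.
have cNf : continuous (fun x => - f x) by move=> x; apply: cvgN; exact: cf.
have [|c /andP[ac ct] fc] := @IVT_le a t (fun x => - f x) (- (f t / 2)) at_ cNf.
  by lra.
have ct' : c < t.
  by rewrite lt_neqAle ct andbT; apply/eqP => e; move: fc; rewrite e; lra.
by have := before c; rewrite ac ct' => /(_ isT); lra.
Qed.

End Calculus.

(** * Integrals of switching controls *)

Section Integration.
Context {R : realType}.
Notation mu := (@lebesgue_measure R).
Implicit Types (a b c x : R) (f g h : R -> R).

Lemma integrable_subitv a b u v f : a <= u -> v <= b ->
  mu.-integrable `[a, b] (EFin \o f) -> mu.-integrable `[u, v] (EFin \o f).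
Proof.
move=> au vb; apply: integrableS => // x /=; rewrite !in_itv /= => /andP[ux xv].
by rewrite (le_trans au ux) (le_trans xv vb).
Qed.

Lemma integral_split a b c f : a <= c -> c <= b ->
  mu.-integrable `[a, b] (EFin \o f) ->
  \int[mu]_(t in `[a, b]) f t =
    \int[mu]_(t in `[a, c]) f t + \int[mu]_(t in `[c, b]) f t.
Proof.
move=> ac cb fi; apply/eqP; rewrite addrC -subr_eq Rintegral_itvB ?bnd_simp//.
rewrite Rintegral_itv_obnd_cbnd//.
by apply: integrableS fi => //; apply: subset_itv; rewrite bnd_simp.
Qed.

(** Both extremal trajectories use a control that changes its law only once. *)
Definition switch c g h t : R := if t < c then g t else h t.

Lemma measurable_switch c g h (D : set R) : measurable D ->
  continuous g -> continuous h -> measurable_fun D (switch c g h).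
Proof.
move=> mD cg ch; apply: (measurable_funS measurableT (@subsetT _ D)).
apply: measurable_fun_ifT.
- by apply: measurable_fun_ltr => //; exact: measurable_cst.
- exact: continuous_measurable_fun.
- exact: continuous_measurable_fun.
Qed.

Lemma integrable_switch c g h a b : continuous g -> continuous h ->
  mu.-integrable `[a, b] (EFin \o switch c g h).
Proof.
move=> cg ch.
have ci f : continuous f -> mu.-integrable `[a, b] (EFin \o f).
  by move=> cf; apply: continuous_integrable; exact: continuous_subspaceT.
have cgh : continuous (fun x => `|g x| + `|h x|).
  by move=> x; apply: cvgD; apply: cvg_norm; [exact: cg|exact: ch].
apply: (le_integrable _ _ _ (ci _ cgh)) => //.
  by apply/measurable_EFinP; exact: measurable_switch.
move=> x _ /=; rewrite lee_fin [leRHS]ger0_norm ?addr_ge0// /switch.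
by case: ifP => _; rewrite ?lerDl ?lerDr.
Qed.

Lemma integral_switch_left c g h a b : continuous g -> continuous h -> b <= c ->
  \int[mu]_(t in `[a, b]) switch c g h t = \int[mu]_(t in `[a, b]) g t.
Proof.
move=> cg ch bc.
have co f : mu.-integrable `[a, b] (EFin \o f) -> mu.-integrable `[a, b[ (EFin \o f).
  by apply: integrableS => //; exact: subset_itv_co_cc.
rewrite -!Rintegral_itv_bndo_bndc.
- apply: eq_Rintegral => x; rewrite inE /= in_itv /= => /andP[_ xb].
  by rewrite /switch (lt_le_trans xb bc).
- by apply: co; apply: continuous_integrable; exact: continuous_subspaceT.
- by apply: co; exact: integrable_switch.
Qed.

Lemma integral_switch_right c g h a b : c <= a ->
  \int[mu]_(t in `[a, b]) switch c g h t = \int[mu]_(t in `[a, b]) h t.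
Proof.
move=> ca; apply: eq_Rintegral => x; rewrite inE /= in_itv /= => /andP[ax _].
by rewrite /switch ltNge (le_trans ca ax).
Qed.

(** The difference, extended by zero, has a vanishing indefinite integral; by
    Lebesgue's differentiation theorem it is almost everywhere the derivative
    of that integral. *)
Lemma ae_eq_of_integrals T (e e' : R -> R) :
  mu.-integrable `[0, T] (EFin \o e) -> mu.-integrable `[0, T] (EFin \o e') ->
  (forall t, 0 <= t <= T ->
    \int[mu]_(u in `[0, t]) e u = \int[mu]_(u in `[0, t]) e' u) ->
  {ae mu, forall t, t \in `[0, T] -> e' t = e t}.
Proof.
move=> ei e'i ee'.
pose d t := e' t - e t.
have mT : measurable (`[0, T]%classic : set (measurableTypeR R)) by [].
have di : mu.-integrable `[0, T] (EFin \o d).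
  by have := integrableB mT e'i ei; apply: eq_integrable.
pose f := d \_ `[0, T].
have fi : mu.-integrable setT (EFin \o f).
  by rewrite /f -restrict_EFin; move: di; rewrite (integrable_mkcond _ mT).
have fy y : mu.-integrable [set` Interval -oo%O (BRight y)] (EFin \o f).
  by apply: integrableS fi.
have fl : locally_integrable setT f by apply: integrable_locally.
have d0 t : 0 <= t <= T -> \int[mu]_(u in `[0, t]) d u = 0.
  move=> /andP[t0 tT].
  by rewrite RintegralB ?ee' ?subrr ?t0 ?tT//; exact: (integrable_subitv (lexx 0) tT).
have F0 x : \int[mu]_(t in `]-oo, x]) f t = 0.
  rewrite /f -Rintegral_mkcondr.
  have [x0|x0] := ltP x 0.
    rewrite [X in \int[mu]_(_ in X) _](_ : _ = set0) ?Rintegral_set0//.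
    apply/seteqP; split=> // y /=; rewrite !in_itv /= => -[yx /andP[y0 _]].
    by move: (le_lt_trans (le_trans y0 yx) x0); rewrite ltxx.
  have [T0|T0] := ltP T 0.
    rewrite [X in \int[mu]_(_ in X) _](_ : _ = set0) ?Rintegral_set0//.
    apply/seteqP; split=> // y /=; rewrite !in_itv /= => -[_ /andP[y0 yT]].
    by move: (le_lt_trans (le_trans y0 yT) T0); rewrite ltxx.
  rewrite -[RHS](d0 (Num.min x T)); last first.
    by rewrite le_min x0 T0 ge_min lexx orbT.
  congr (\int[mu]_(_ in _) _); apply/seteqP; split => y /=; rewrite !in_itv /= le_min.
    by move=> [-> /andP[-> ->]].
  by move=> /andP[-> /andP[-> ->]].
have := FTC1Ny fy fl.
apply: filterS; first exact: (ae_filter_ringOfSetsType mu).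
move=> t /= [_]; rewrite (_ : (fun x => _) = cst 0); last by apply/funext => x; exact: F0.
rewrite derive1_cst /f patchE => ft tT; move: ft.
by rewrite mem_set// /d => /esym/subr0_eq.
Qed.

End Integration.

(** * Growth function and density index *)

(** The quotient [f x / x] does not increase: [x] is the convex combination of
    [y] and [0] with weight [x / y]. Stated without division. *)
Lemma concave_ray {R : realType} (D : set R) (f : R -> R) (x y : R) :
  concave_on D f -> D 0 -> D y -> f 0 = 0 -> 0 <= x <= y -> x * f y <= y * f x.
Proof.
move=> cf D0 Dy f0 /andP[x0 xy].
have [y0|y0] := leP y 0.
  have -> : x = 0 by apply/eqP; rewrite eq_le x0 (le_trans xy y0).
  have -> : y = 0 by apply/eqP; rewrite eq_le y0 (le_trans x0 xy).
  by [].
have t0 : 0 <= x / y by rewrite divr_ge0// ltW.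
have t1 : x / y <= 1 by rewrite ler_pdivrMr// mul1r.
have := cf (Itv01 t0 t1) y 0 (mem_set Dy) (mem_set D0).
have -> : conv (Itv01 t0 t1) (y : convex_lmodType R^o) 0 = x.
  transitivity (x / y * y + (1 - x / y) * 0) => //.
  by rewrite mulr0 addr0 divfK ?gt_eqF.
rewrite convRE /= f0 oppr0 mulr0 addr0.
by rewrite mulrN lerN2 mulrAC ler_pdivrMr// [leRHS]mulrC.
Qed.

Section Density.
Context {R : realType} (M : forest R) (HM : standing M).
Hypotheses (g_incr : {in J M &, {homo g M : x y / x <= y}})
  (g_conc : concave_on (J M) (g M)) (g_0 : g M 0 = 0) (g_1 : g M 1 = 1)
  (g_gt : {in `]0, 1[, forall x, x < g M x}).
Notation a := (expq M / 2).
Implicit Types (x r : R).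

Lemma a_range : 1 / 2 < a < 1.
Proof. by have /andP[] := expq_range HM; lra. Qed.

Lemma a_gt0 : 0 < a. Proof. by have := a_range; lra. Qed.

Lemma A_gt0 : 0 < coefA M. Proof. by have /andP[] := coefA_range HM. Qed.

Lemma nmin_pos : 0 < nmin M. Proof. exact: nmin_gt0 HM. Qed.

Lemma n0_pos : 0 < n0 M. Proof. exact: lt_le_trans nmin_pos (n0_ge HM). Qed.

Lemma J01 r : 0 <= r <= 1 -> J M r.
Proof. by move=> r01; apply: (J_unit HM); rewrite /= in_itv. Qed.

Lemma g_ray x y : 0 <= x <= y -> y <= 1 -> x * g M y <= y * g M x.
Proof.
move=> xy y1; apply: (concave_ray g_conc) => //; apply: J01.
  by rewrite lexx ler01.
by case/andP: xy => x0 xy; rewrite y1 (le_trans x0 xy).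
Qed.

Lemma g_ge0 r : 0 <= r <= 1 -> 0 <= g M r.
Proof.
move=> r01; rewrite -g_0; apply: g_incr; last by case/andP: r01.
  by rewrite inE; apply: J01; rewrite lexx ler01.
by rewrite inE; apply: J01.
Qed.

Lemma g_gt0 r : 0 < r <= 1 -> 0 < g M r.
Proof.
case/andP=> r0; rewrite le_eqVlt => /predU1P[->|r1]; first by rewrite g_1.
by apply: (lt_trans r0); apply: g_gt; rewrite in_itv /= r0.
Qed.

Lemma g_fixpoint r : 0 < r <= 1 -> g M r = r -> r = 1.
Proof.
case/andP=> r0; rewrite le_eqVlt => /orP[/eqP//|r1] gr.
have : r \in `]0, 1[ by rewrite in_itv /= r0.
by move=> /g_gt; rewrite gr ltxx.
Qed.

Lemma g_clamp_continuous : continuous (g M \o clamp 0 1).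
Proof.
apply: continuous_comp_clamp => //.
exact: continuous_subspaceW (J_unit HM) (g_continuous HM).
Qed.

Lemma density_gt0 n x : 0 < n -> 0 < x -> 0 < density M n x.
Proof. by move=> n0 x0; rewrite /density !mulr_gt0 ?A_gt0// powR_gt0. Qed.

Lemma density_ge0 n x : 0 <= n -> 0 <= density M n x.
Proof. by move=> n0; rewrite /density !mulr_ge0 ?powR_ge0// ltW// A_gt0. Qed.

Lemma density_mono n n' x x' : 0 <= n <= n' -> 0 <= x <= x' ->
  density M n x <= density M n' x'.
Proof.
case/andP=> h1 h2 /andP[x1 x2]; have A0 := ltW A_gt0.
rewrite /density ler_pM ?mulr_ge0 ?powR_ge0 ?ler_wpM2l//.
by rewrite ge0_ler_powR// ?nnegrE ?(ltW a_gt0)// (le_trans x1).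
Qed.

Lemma density_continuous (n x : R -> R) :
  continuous n -> continuous x -> (forall t, 0 < x t) ->
  continuous (fun t => density M (n t) (x t)).
Proof.
move=> cn cx x0 t; rewrite /density.
apply: cvgM; first by apply: cvgM; [exact: cvg_cst|exact: cn].
apply: (@cvg_comp _ _ _ x (fun y => y `^ a)); first exact: cx.
exact: (is_derive_continuous (is_derive1_powR a (x0 t))).
Qed.

(** The basal area at which [n] trees have density index 1. *)
Definition full_area (n : R) : R := (coefA M * n) `^ (- a^-1).

Lemma full_area_gt0 n : 0 < n -> 0 < full_area n.
Proof. by move=> n0; rewrite powR_gt0// mulr_gt0// A_gt0. Qed.

Lemma powR_full_area n : 0 < n -> full_area n `^ a = (coefA M * n)^-1.
Proof.
move=> n0; rewrite /full_area -powRrM mulNr mulVf ?gt_eqF ?a_gt0// powR_inv1//.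
by rewrite mulr_ge0// ltW// A_gt0.
Qed.

Lemma density_full_area n : 0 < n -> density M n (full_area n) = 1.
Proof.
by move=> n0; rewrite /density powR_full_area// divff// gt_eqF// mulr_gt0// A_gt0.
Qed.

Lemma density_le1 n x : 0 < n -> 0 < x ->
  (density M n x <= 1) = (x <= full_area n).
Proof.
move=> n0 x0; rewrite -(density_full_area n0).
rewrite /density ler_pM2l ?mulr_gt0 ?A_gt0//.
have f0 := full_area_gt0 n0.
apply/idP/idP; last first.
  by move=> h; rewrite ge0_ler_powR// ?nnegrE ?ltW// a_gt0.
by apply: contraTT; rewrite -!ltNge => h;
  rewrite gt0_ltr_powR// ?nnegrE ?ltW// a_gt0.
Qed.

Lemma density_eq1 n x : 0 < n -> 0 < x -> density M n x = 1 -> x = full_area n.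
Proof.
move=> n0 x0; rewrite -(density_full_area n0) /density => /mulfI e.
have An0 : coefA M * n != 0 by rewrite gt_eqF ?mulr_gt0 ?A_gt0.
apply: (powR_injective a_gt0 _ _ (e An0)); rewrite nnegrE ltW//.
exact: full_area_gt0.
Qed.

Lemma s0_lt_full_area : s0 M < full_area (n0 M).
Proof.
rewrite ltNge; apply/negP => h.
have := density0_lt1 HM; rewrite ltNge => /negP; apply.
rewrite -(density_full_area n0_pos); apply: density_mono.
  by rewrite lexx (ltW n0_pos).
by rewrite h ltW// full_area_gt0// n0_pos.
Qed.

Lemma full_area_le n n' : 0 < n <= n' -> full_area n' <= full_area n.
Proof.
case/andP=> n0 nn'; have n'0 := lt_le_trans n0 nn'.
rewrite -density_le1 ?full_area_gt0// -[leRHS](density_full_area n'0).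
apply: density_mono; first by rewrite nn' ltW.
by rewrite lexx ltW// full_area_gt0.
Qed.

End Density.

(** * The slowest growth and its two clocks *)

Section Clocks.
Context {R : realType} (M : forest R) (HM : standing M).
Hypotheses (g_incr : {in J M &, {homo g M : x y / x <= y}})
  (g_conc : concave_on (J M) (g M)) (g_0 : g M 0 = 0) (g_1 : g M 1 = 1)
  (g_gt : {in `]0, 1[, forall x, x < g M x}).
Notation mu := (@lebesgue_measure R).
Notation a := (expq M / 2).
Notation Ts := (Tstar M).
Implicit Types (x r t u T : R).

(** The least possible value of [ds/dt] per unit of [V] at basal area [x]. As
    [g r / r] does not increase, [g r / n] is smallest for the largest tree
    number compatible with [n <= n(0)] and [r <= 1]: if [x] is so small that
    [n(0)] trees do not fill the stand this number is [n(0)], otherwise it is the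
    one for which [r = 1]. The formula covers both cases. *)
Definition slow_rate x : R :=
  let r := density M (n0 M) x in g M (Num.min 1 r) * Num.max 1 r / n0 M.

(** Admissible trajectories keep their basal area between [s(0)] and the area
    at which [nmin] trees fill the stand. *)
Definition area_clamp x := clamp (s0 M) (full_area M (nmin M)) x.

(** The slowest growth [ds/dt = slow_rate s * V t] is separable. It reads
    [area_clock (s t) = time_clock t], where the first clock integrates the
    inverse of the rate and the second one integrates [V]. *)
Definition area_clock := primitive (s0 M) (fun x => (slow_rate (area_clamp x))^-1).

Definition time_clock := primitive 0 (V M \o clamp 0 Ts).

Notation H := area_clock.
Notation W := time_clock.
Notation smax := (full_area M (nmin M)).

Lemma s0_lt_smax : s0 M < smax.
Proof.
apply: (lt_le_trans (s0_lt_full_area HM)); apply: full_area_le => //.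
by rewrite (nmin_pos HM) (n0_ge HM).
Qed.

Lemma area_clamp_range x : s0 M <= area_clamp x <= smax.
Proof. by apply: clamp_itv; exact: ltW s0_lt_smax. Qed.

Lemma area_clamp_gt0 x : 0 < area_clamp x.
Proof. by case/andP: (area_clamp_range x) => h _; exact: lt_le_trans (s0_gt0 HM) h. Qed.

Lemma slow_rate_gt0 x : 0 < x -> 0 < slow_rate x.
Proof.
move=> x0; have d0 := density_gt0 HM (n0_pos HM) x0.
rewrite /slow_rate /= divr_gt0 ?n0_pos// mulr_gt0//.
  by apply: (g_gt0 g_1 g_gt); rewrite lt_min ltr01 d0 ge_min lexx.
by rewrite lt_max ltr01.
Qed.

Lemma slow_rate_below x : 0 < x <= full_area M (n0 M) ->
  slow_rate x = g M (density M (n0 M) x) / n0 M.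
Proof.
case/andP=> x0; rewrite -density_le1 ?n0_pos// => d1.
by rewrite /slow_rate /= (min_idPr d1) (max_idPl d1) mulr1.
Qed.

(** Here [r = 1] and [g r = 1], so the rate no longer involves [g]: this is
    what makes the maximal time explicit. *)
Lemma slow_rate_above x : full_area M (n0 M) <= x ->
  slow_rate x = coefA M * x `^ a.
Proof.
move=> fx; have x0 := lt_le_trans (full_area_gt0 HM (n0_pos HM)) fx.
have d1 : 1 <= density M (n0 M) x.
  rewrite -(density_full_area HM (n0_pos HM)); apply: density_mono => //.
    by rewrite lexx ltW// n0_pos.
  by rewrite fx ltW// full_area_gt0// n0_pos.
rewrite /slow_rate /= (min_idPl d1) (max_idPr d1) g_1 mul1r /density.
by rewrite mulrAC mulfK// gt_eqF// n0_pos.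
Qed.

Lemma slow_rate_continuous : continuous (slow_rate \o area_clamp).
Proof.
pose d x := density M (n0 M) (area_clamp x).
have cd : continuous d.
  apply: (@density_continuous _ _ (cst (n0 M))).
  - by move=> x; exact: cvg_cst.
  - exact: continuous_clamp.
  - exact: area_clamp_gt0.
rewrite (_ : _ \o _ = fun x => (g M \o clamp 0 1) (d x) * Num.max 1 (d x) / n0 M); last first.
  apply/funext => x /=; rewrite /slow_rate /=; congr (g M _ * _ / _).
  rewrite /clamp; apply/esym/max_idPr; rewrite le_min ler01.
  by rewrite density_ge0// ltW// n0_pos.
move=> x; apply: cvgM; last exact: cvg_cst.
apply: cvgM.
  by apply: (@cvg_comp _ _ _ d _ _ _ _ (cd x)); exact: g_clamp_continuous.
by apply: (@continuous_max _ R (cst 1) d); [exact: cvg_cst|exact: cd].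
Qed.

Lemma area_clockP : [/\ H (s0 M) = 0, cancel H (inverse H), cancel (inverse H) H,
  forall x : R, is_derive x 1 H (slow_rate (area_clamp x))^-1 &
  forall y : R, is_derive y 1 (inverse H) (slow_rate (area_clamp (inverse H y)))].
Proof.
have F0 x : 0 < slow_rate (area_clamp x) by apply/slow_rate_gt0/area_clamp_gt0.
have cH : continuous (fun x => (slow_rate (area_clamp x))^-1).
  move=> x; apply: cvgV; last exact: slow_rate_continuous.
  by rewrite gt_eqF.
have [H0 dH] := primitiveP (s0 M) cH.
have [|c _ Fc] := @EVT_max R (slow_rate \o area_clamp) (s0 M) smax (ltW s0_lt_smax).
  by apply: continuous_subspaceT; exact: slow_rate_continuous.
have cinv : 0 < (slow_rate (area_clamp c))^-1 by rewrite invr_gt0.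
have [x|K1 K2 dinv] := derive_bounded_below_inverse cinv dH.
  rewrite lef_pV2 ?posrE//.
  have := Fc (area_clamp x); rewrite in_itv /= area_clamp_range => /(_ isT).
  by rewrite {1}/area_clamp clamp_id ?area_clamp_range.
split => // y; apply: is_derive_eq.
by rewrite invrK.
Qed.

Lemma V_clamp_gt0 t : 0 < V M (clamp 0 Ts t).
Proof.
by apply: (V_gt0 HM); rewrite in_itv /= clamp_itv// ltW// Tstar_gt0.
Qed.

Lemma V_clamp_continuous : continuous (V M \o clamp 0 Ts).
Proof.
apply: continuous_comp_clamp; first by rewrite ltW// Tstar_gt0.
exact: V_continuous HM.
Qed.

Lemma time_clockP : [/\ W 0 = 0, cancel W (inverse W), cancel (inverse W) W &
  forall t : R, is_derive t 1 W (V M (clamp 0 Ts t))].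
Proof.
have [W0 dW] := primitiveP 0 V_clamp_continuous.
have Ts0 := ltW (Tstar_gt0 HM).
have [|c _ Vc] := @EVT_min R (V M \o clamp 0 Ts) 0 Ts Ts0.
  by apply: continuous_subspaceT; exact: V_clamp_continuous.
have [t|K1 K2 _] := derive_bounded_below_inverse (V_clamp_gt0 c) dW.
  have := Vc (clamp 0 Ts t); rewrite in_itv /= clamp_itv// => /(_ isT).
  by rewrite [clamp _ _ (clamp _ _ _)]clamp_id ?clamp_itv.
by split.
Qed.

Lemma time_clock_lt t u : t < u -> W t < W u.
Proof.
move=> tu; have [_ _ _ dW] := time_clockP.
by apply: (derive_gt0_lt tu) => // x _; exact: V_clamp_gt0.
Qed.

Lemma time_clock_le t u : (W t <= W u) = (t <= u).
Proof. by apply: le_mono t u; exact: time_clock_lt. Qed.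

Lemma area_clock_lt x y : x < y -> H x < H y.
Proof.
move=> xy; have [_ _ _ dH _] := area_clockP.
apply: (derive_gt0_lt xy) => // z _.
by rewrite invr_gt0; apply/slow_rate_gt0/area_clamp_gt0.
Qed.

Lemma area_clock_le x y : (H x <= H y) = (x <= y).
Proof. by apply: le_mono x y; exact: area_clock_lt. Qed.

(** With [d] the density index of [n] trees, [d0] that of [n(0)] trees and
    [m = min 1 d0], the claim is [g m / m <= g d / d] multiplied by [d0 / n(0)],
    which is also [d / n]. *)
Lemma slow_rate_min n x : nmin M <= n <= n0 M -> s0 M <= x ->
  density M n x <= 1 -> slow_rate x <= g M (density M n x) / n.
Proof.
case/andP=> nn nn0 sx d1.
have n_gt0 := lt_le_trans (nmin_pos HM) nn; have n0_gt0 := n0_pos HM.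
have x0 := lt_le_trans (s0_gt0 HM) sx.
rewrite /slow_rate /=; set d0 := density M (n0 M) x.
set d := density M n x in d1 *.
have dn : d * n0 M = d0 * n by rewrite /d /d0 /density; ring.
have d_gt0 : 0 < d by exact: density_gt0.
have d0_gt0 : 0 < d0 by exact: density_gt0.
have m_gt0 : 0 < Num.min 1 d0 by rewrite lt_min ltr01.
have dd0 : d <= d0.
  by apply: density_mono => //; rewrite ?nn0 ?lexx ltW.
have m01 : Num.min 1 d0 <= 1 by rewrite ge_min lexx.
have dm : 0 <= d <= Num.min 1 d0 by rewrite (ltW d_gt0) le_min d1 dd0.
have ray := g_ray HM g_conc g_0 dm m01.
have mM : Num.min 1 d0 * Num.max 1 d0 = d0.
  by case: (leP 1 d0) => _; rewrite ?mul1r ?mulr1.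
rewrite ler_pdivrMr// mulrAC ler_pdivlMr//.
rewrite -(ler_pM2l d_gt0) -(ler_pM2l m_gt0).
rewrite [leRHS](_ : _ = (Num.min 1 d0 * g M d) * (d * n0 M)); last by ring.
rewrite [leLHS](_ : _ = (d * g M (Num.min 1 d0)) *
  ((Num.min 1 d0 * Num.max 1 d0) * n)); last by ring.
by rewrite dn mM ler_wpM2r// ltW// mulr_gt0.
Qed.

Section Admissible.
Variables (T : R) (e s n : R -> R).
Hypotheses (adm : admissible M T e s n) (T0 : 0 <= T) (TTs : T <= Ts).

Let sol : solution M T e s n. Proof. by case: adm. Qed.

Let itvT t : 0 <= t <= T -> t \in `[0, T]. Proof. by rewrite in_itv. Qed.

Let sub t : 0 <= t <= T -> 0 <= t <= Ts.
Proof. by case/andP=> t0 tT; rewrite t0 (le_trans tT). Qed.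

Lemma adm_control t : 0 <= t <= T -> 0 <= e t <= emax M.
Proof. by move=> /itvT tT; case: adm => _ /(_ t tT)[]. Qed.

Lemma adm_nmin t : 0 <= t <= T -> nmin M <= n t.
Proof. by move=> /itvT tT; case: adm => _ /(_ t tT)[]. Qed.

Lemma adm_density t : 0 <= t <= T -> density M (n t) (s t) <= 1.
Proof. by move=> /itvT tT; case: adm => _ /(_ t tT)[]. Qed.

Lemma adm_n_gt0 t : 0 <= t <= T -> 0 < n t.
Proof. by move=> tT; apply: lt_le_trans (nmin_pos HM) (adm_nmin tT). Qed.

Lemma adm_n_step u v : 0 <= u <= v -> v <= T ->
  0 <= n u - n v <= emax M * (v - u).
Proof.
case/andP=> u0 uv vT; have v0 := le_trans u0 uv.
have ei := control_integrable sol.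
have uT : 0 <= u <= T by rewrite u0 (le_trans uv).
have vT' : 0 <= v <= T by rewrite v0 vT.
have -> : n u - n v = \int[mu]_(x in `[u, v]) e x.
  rewrite !(n_eq sol) ?itvT// (@integral_split _ 0 v u)//; first by ring.
  exact: (integrable_subitv (lexx 0) vT).
have eb x : `[u, v]%classic x -> 0 <= e x <= emax M.
  rewrite /= in_itv /= => /andP[ux xv]; apply: adm_control.
  by rewrite (le_trans u0 ux) (le_trans xv vT).
apply/andP; split.
  by apply: Rintegral_ge0 => x /eb /andP[].
have <- : \int[mu]_(x in `[u, v]) emax M = emax M * (v - u).
  have cc : {within `[u, v], continuous (cst (emax M) : R -> R)}.
    by apply: continuous_subspaceT => x; exact: cvg_cst.
  have dF (x : R) : u <= x <= v -> is_derive x 1 (fun x : R => emax M * x) (cst (emax M) x).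
    by move=> _; apply: is_derive_eq; rewrite scaler1.
  by rewrite (integral_derive uv cc dF) mulrBr.
apply: le_Rintegral => //.
- exact: (integrable_subitv u0 vT).
- by apply: continuous_integrable; apply: continuous_subspaceT => x; exact: cvg_cst.
- by move=> x /eb /andP[].
Qed.

Lemma adm_n0 : n 0 = n0 M.
Proof. by rewrite (n_eq sol) ?itvT ?lexx// set_itv1 Rintegral_set1 subr0. Qed.

Lemma adm_n_le t : 0 <= t <= T -> n t <= n0 M.
Proof.
case/andP=> t0 tT; rewrite -adm_n0.
by have := @adm_n_step 0 t; rewrite lexx t0 tT subr_ge0 => /(_ isT isT)/andP[].
Qed.

Let density01 t : 0 <= t <= T -> 0 <= density M (n t) (s t) <= 1.
Proof.
by move=> tT; rewrite adm_density// density_ge0// ltW// adm_n_gt0.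
Qed.

Lemma adm_growth_ge0 t : 0 <= t <= T -> 0 <= growth M n s t.
Proof.
move=> tT; rewrite /growth mulr_ge0//.
  by rewrite divr_ge0 ?(g_ge0 HM g_incr g_0) ?density01// ltW// adm_n_gt0.
by rewrite ltW// (V_gt0 HM)// in_itv /= sub.
Qed.

Lemma adm_s0_le t : 0 <= t <= T -> s0 M <= s t.
Proof.
move=> tT; rewrite (s_eq sol) ?itvT// lerDl; apply: Rintegral_ge0 => x.
rewrite /= in_itv /= => /andP[x0 xt]; apply: adm_growth_ge0.
by rewrite x0 (le_trans xt)//; case/andP: tT.
Qed.

Lemma adm_s_gt0 t : 0 <= t <= T -> 0 < s t.
Proof. by move=> tT; apply: lt_le_trans (s0_gt0 HM) (adm_s0_le tT). Qed.

Lemma adm_s_le t : 0 <= t <= T -> s t <= smax.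
Proof.
move=> tT; rewrite -density_le1 ?nmin_pos ?adm_s_gt0//.
apply: le_trans (adm_density tT); apply: density_mono => //.
  by rewrite adm_nmin// ltW// nmin_pos.
by rewrite lexx ltW// adm_s_gt0.
Qed.

Lemma adm_area_clamp t : 0 <= t <= T -> area_clamp (s t) = s t.
Proof. by move=> tT; rewrite /area_clamp clamp_id// adm_s0_le// adm_s_le. Qed.

Let int_clamp_continuous (f : R -> R) : mu.-integrable `[0, T] (EFin \o f) ->
  continuous (fun t => \int[mu]_(u in `[0, clamp 0 T t]) f u).
Proof.
move=> fi; apply: (@continuous_comp_clamp _ 0 T (fun t => \int[mu]_(u in `[0, t]) f u)) => //.
exact: parameterized_integral_continuous.
Qed.

Let clampT t : 0 <= clamp 0 T t <= T. Proof. exact: clamp_itv. Qed.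

Lemma adm_n_continuous : continuous (n \o clamp 0 T).
Proof.
rewrite (_ : _ \o _ = fun t => n0 M - \int[mu]_(u in `[0, clamp 0 T t]) e u).
  move=> t; apply: cvgB; first exact: cvg_cst.
  exact: (int_clamp_continuous (control_integrable sol)).
by apply/funext => t /=; rewrite (n_eq sol)// itvT// clampT.
Qed.

Lemma adm_s_continuous : continuous (s \o clamp 0 T).
Proof.
rewrite (_ : _ \o _ = fun t => s0 M + \int[mu]_(u in `[0, clamp 0 T t]) growth M n s u).
  move=> t; apply: cvgD; first exact: cvg_cst.
  exact: (int_clamp_continuous (growth_integrable sol)).
by apply/funext => t /=; rewrite (s_eq sol)// itvT// clampT.
Qed.

(** The control does not appear in the growth rate, which is therefore
    continuous even though the control is not. *)
Lemma adm_growth_continuous : continuous (growth M n s \o clamp 0 T).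
Proof.
rewrite (_ : _ \o _ = fun t => (g M \o clamp 0 1) (density M ((n \o clamp 0 T) t)
    ((s \o clamp 0 T) t)) / (n \o clamp 0 T) t * (V M \o clamp 0 Ts) (clamp 0 T t)); last first.
  apply/funext => t /=; rewrite /growth [clamp 0 1 _]clamp_id ?density01//.
  by rewrite [clamp 0 Ts _]clamp_id// sub.
move=> t; apply: cvgM; last first.
  apply: (@cvg_comp _ _ _ (clamp 0 T) _ _ _ _ (@continuous_clamp _ 0 T t)).
  exact: V_clamp_continuous.
apply: cvgM; last first.
  by apply: cvgV; [rewrite /= gt_eqF// adm_n_gt0|exact: adm_n_continuous].
apply: (@cvg_comp _ _ _ (fun t => density M ((n \o clamp 0 T) t) ((s \o clamp 0 T) t))).
  apply: (density_continuous adm_n_continuous adm_s_continuous) => u /=.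
  exact: adm_s_gt0.
exact: g_clamp_continuous.
Qed.

(** The basal area extends to a function that is differentiable at every point
    of the segment, end points included. *)
Lemma adm_smooth : exists2 X : R -> R,
  forall t, 0 <= t <= T -> X t = s t &
  forall t, 0 <= t <= T -> is_derive t 1 X (growth M n s t).
Proof.
have [P0 dP] := primitiveP 0 adm_growth_continuous.
exists (fun t => s0 M + primitive 0 (growth M n s \o clamp 0 T) t).
  move=> t tT; rewrite (s_eq sol) ?itvT//; congr (_ + _).
  rewrite -[LHS]subr0 -{3}P0 -(@integral_derive _ 0 t (growth M n s \o clamp 0 T))//.
  - apply: eq_Rintegral => u; rewrite inE /= in_itv /= => /andP[u0 ut].
    by rewrite clamp_id// u0 (le_trans ut)//; case/andP: tT.
  - by case/andP: tT.
  - by apply: continuous_subspaceT; exact: adm_growth_continuous.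
move=> t tT; have := dP t; rewrite /= clamp_id// => dPt.
by rewrite -[growth _ _ _ _]add0r; apply: is_deriveD.
Qed.

(** The area clock runs at least as fast as the time clock along every
    admissible trajectory; the derivative of their difference measures how far
    the growth is from the slowest one. *)
Lemma adm_clock : exists2 K : R -> R,
  forall t, 0 <= t <= T -> K t = H (s t) - W t &
  forall t, 0 <= t <= T -> is_derive t 1 K
    ((g M (density M (n t) (s t)) / n t / slow_rate (s t) - 1) * V M t).
Proof.
have [X Xs dX] := adm_smooth; have [_ _ _ dH _] := area_clockP.
have [_ _ _ dW] := time_clockP.
exists (fun t => H (X t) - W t); first by move=> t tT; rewrite Xs.
move=> t tT.
have d1 : is_derive t 1 (H \o X) ((slow_rate (s t))^-1 * growth M n s t).
  have := dX t tT; have := dH (X t); rewrite Xs// adm_area_clamp// -Xs//.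
  by move=> h1 h2; exact: is_derive1_comp.
have := dW t; rewrite clamp_id ?sub// => d2.
apply: (is_derive_eq (is_deriveB d1 d2)); rewrite /growth; ring.
Qed.

Let excess_ge0 t : 0 <= t <= T ->
  0 <= (g M (density M (n t) (s t)) / n t / slow_rate (s t) - 1) * V M t.
Proof.
move=> tT; rewrite mulr_ge0//; last by rewrite ltW// (V_gt0 HM)// in_itv /= sub.
rewrite subr_ge0 ler_pdivlMr ?slow_rate_gt0 ?adm_s_gt0// mul1r.
by apply: slow_rate_min; rewrite ?adm_s0_le ?adm_density// adm_nmin ?adm_n_le.
Qed.

Lemma adm_s0 : s 0 = s0 M.
Proof. by rewrite (s_eq sol) ?itvT ?lexx// set_itv1 Rintegral_set1 addr0. Qed.

Let clock0 : H (s 0) - W 0 = 0.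
Proof.
have [H0 _ _ _ _] := area_clockP; have [W0 _ _ _] := time_clockP.
by rewrite adm_s0 H0 W0 subrr.
Qed.

Lemma adm_clock_le t : 0 <= t <= T -> W t <= H (s t).
Proof.
move=> /andP[t0 tT]; have [K KE dK] := adm_clock.
have tT' : 0 <= t <= T by rewrite t0.
rewrite -subr_ge0 -KE// -clock0 -KE ?lexx//.
apply: (derive_ge0_le t0 (df := fun t =>
  (g M (density M (n t) (s t)) / n t / slow_rate (s t) - 1) * V M t)).
  by move=> x /andP[x0 xt]; apply: dK; rewrite x0 (le_trans xt).
by move=> x /andP[x0 xt]; apply: excess_ge0; rewrite ltW// ltW// (lt_le_trans xt).
Qed.

(** If both clocks agree at the final time then, their difference being
    nondecreasing from 0, they have agreed all along and the growth has always
    been the slowest one. *)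
Lemma adm_clock_eq : W T = H (s T) ->
  (forall t, 0 <= t <= T -> H (s t) = W t) /\
  (forall t, 0 < t < T -> g M (density M (n t) (s t)) / n t = slow_rate (s t)).
Proof.
move=> WH; have [K KE dK] := adm_clock.
have K0T : K 0 = K T by rewrite !KE ?lexx ?T0// clock0 WH subrr.
have [|c1 c2] := derive_ge0_const K0T dK.
  by move=> x /andP[x0 xT]; apply: excess_ge0; rewrite !ltW.
split=> t tT.
  by apply/eqP; rewrite -subr_eq0 -KE// c1// KE ?lexx// clock0.
have tT' : 0 <= t <= T by case/andP: tT => ? ?; rewrite !ltW.
have V0 : V M t != 0 by rewrite gt_eqF// (V_gt0 HM)// in_itv /= sub.
have := c2 t tT => /eqP; rewrite mulf_eq0 (negbTE V0) orbF subr_eq0 => /eqP e1.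
by rewrite -[RHS]mul1r -e1 divfK// gt_eqF// slow_rate_gt0// adm_s_gt0.
Qed.

End Admissible.
End Clocks.

(** * The trajectory E^0 and the maximal time *)

Section Slow.
Context {R : realType} (M : forest R) (HM : standing M).
Hypotheses (g_incr : {in J M &, {homo g M : x y / x <= y}})
  (g_conc : concave_on (J M) (g M)) (g_0 : g M 0 = 0) (g_1 : g M 1 = 1)
  (g_gt : {in `]0, 1[, forall x, x < g M x}).
Notation mu := (@lebesgue_measure R).
Notation a := (expq M / 2).
Notation Ts := (Tstar M).
Notation H := (area_clock M).
Notation W := (time_clock M).
Notation smax := (full_area M (nmin M)).
Notation sfull := (full_area M (n0 M)).
Implicit Types (x r t u T : R).

(** The basal area of the trajectory E^0, obtained by reading the area clock
    backwards. *)
Definition slow_area t := inverse H (W t).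
(** The time [t^0] at which the density index reaches 1. *)
Definition closing_time := inverse W (H sfull).
Definition slow_number t : R :=
  if t <= closing_time then n0 M else (coefA M)^-1 * slow_area t `^ (- a).
(** The control that keeps the density index equal to 1, made continuous on
    the line. *)
Definition slow_e_r t : R := a * (V M (clamp 0 Ts t) / area_clamp M (slow_area t)).
(** Capping the control at [emax] makes its bounds unconditional; that the cap
    is inactive is the content of [slow_e_r_lt]. *)
Definition slow_control :=
  switch closing_time (cst 0) (fun t => Num.min (emax M) (slow_e_r t)).

Let clocks := area_clockP HM g_1 g_gt.
Let Hle := area_clock_le HM g_1 g_gt.
Let Wlt := time_clock_lt HM.
Let Wle := time_clock_le HM.

Lemma area_clock_slow t : H (slow_area t) = W t.
Proof. by have [_ _ K _ _] := clocks; rewrite /slow_area K. Qed.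

Lemma time_clock_closing : W closing_time = H sfull.
Proof. by have [_ _ K _] := time_clockP HM; rewrite /closing_time K. Qed.

Lemma slow_area_le t x : (slow_area t <= x) = (W t <= H x).
Proof. by rewrite -Hle area_clock_slow. Qed.

Lemma slow_area_lt t x : (slow_area t < x) = (W t < H x).
Proof.
by rewrite !ltNge -Hle area_clock_slow.
Qed.

Lemma slow_area_full_le t : (slow_area t <= sfull) = (t <= closing_time).
Proof. by rewrite slow_area_le -time_clock_closing Wle. Qed.

Lemma slow_area0 : slow_area 0 = s0 M.
Proof.
have [H0 K _ _ _] := clocks; have [W0 _ _ _] := time_clockP HM.
by rewrite /slow_area W0 -H0 K.
Qed.

Lemma closing_time_gt0 : 0 < closing_time.
Proof.
rewrite ltNge -Wle time_clock_closing -ltNge.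
by rewrite -slow_area_lt slow_area0 s0_lt_full_area.
Qed.

Lemma slow_area_ge t : 0 <= t -> s0 M <= slow_area t.
Proof. by move=> t0; rewrite -Hle area_clock_slow -slow_area0 area_clock_slow Wle. Qed.

Lemma slow_area_gt0 t : 0 <= t -> 0 < slow_area t.
Proof. by move=> /slow_area_ge; apply: lt_le_trans; exact: s0_gt0 HM. Qed.

Lemma is_derive_slow_area t : is_derive t (1 : R) slow_area
  (slow_rate M (area_clamp M (slow_area t)) * V M (clamp 0 Ts t)).
Proof.
have [_ _ _ _ dH] := clocks; have [_ _ _ dW] := time_clockP HM.
exact: is_derive1_comp (dH (W t)) (dW t).
Qed.

Lemma slow_area_continuous : continuous slow_area.
Proof. by move=> t; exact: is_derive_continuous (is_derive_slow_area t). Qed.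

Lemma slow_e_r_continuous : continuous slow_e_r.
Proof.
have cs : continuous (fun t => area_clamp M (slow_area t)).
  move=> t; apply: (@continuous_comp _ _ _ slow_area (area_clamp M)).
    exact: slow_area_continuous.
  exact: continuous_clamp.
move=> t; apply: cvgM; first exact: cvg_cst.
apply: cvgM; first exact: V_clamp_continuous.
apply: cvgV; first by rewrite gt_eqF// area_clamp_gt0.
exact: cs.
Qed.

Lemma slow_rhs_continuous : continuous (fun t => Num.min (emax M) (slow_e_r t)).
Proof.
move=> t; apply: (@continuous_min _ R (cst (emax M)) slow_e_r); first exact: cvg_cst.
exact: slow_e_r_continuous.
Qed.

Lemma slow_numberE t : closing_time <= t ->
  slow_number t = (coefA M)^-1 * slow_area t `^ (- a).
Proof.
rewrite /slow_number le_eqVlt => /predU1P[<-|]; last by rewrite ltNge => /negbTE ->.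
have -> : slow_area closing_time = sfull.
  by have [_ K _ _ _] := clocks; rewrite /slow_area time_clock_closing K.
by rewrite lexx powRN powR_full_area ?n0_pos// invrK mulKf// gt_eqF// A_gt0.
Qed.

Lemma slow_number_gt0 t : 0 <= t -> 0 < slow_number t.
Proof.
move=> t0; rewrite /slow_number; case: ifP => _; first exact: n0_pos.
by rewrite mulr_gt0 ?invr_gt0 ?A_gt0// powR_gt0// slow_area_gt0.
Qed.

Lemma slow_density_after t : closing_time <= t ->
  density M (slow_number t) (slow_area t) = 1.
Proof.
move=> ct; have s0 := slow_area_gt0 (le_trans (ltW closing_time_gt0) ct).
rewrite slow_numberE// /density powRN mulrA divff ?gt_eqF ?A_gt0// mul1r mulVf//.
by rewrite gt_eqF// powR_gt0.
Qed.

Lemma slow_density_before t : 0 <= t < closing_time ->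
  density M (slow_number t) (slow_area t) < 1.
Proof.
case/andP=> t0 tc; rewrite /slow_number ltW// -(density_full_area HM (n0_pos HM)).
rewrite /density ltr_pM2l ?mulr_gt0 ?A_gt0 ?n0_pos//.
rewrite gt0_ltr_powR ?a_gt0// ?nnegrE ?ltW ?slow_area_gt0 ?full_area_gt0 ?n0_pos//.
by rewrite slow_area_lt -time_clock_closing Wlt.
Qed.

Lemma slow_density_le1 t : 0 <= t -> density M (slow_number t) (slow_area t) <= 1.
Proof.
move=> t0; have [ct|tc] := leP closing_time t; first by rewrite slow_density_after.
by rewrite ltW// slow_density_before// t0.
Qed.

Lemma slow_growth t : 0 <= t ->
  growth M slow_number slow_area t = slow_rate M (slow_area t) * V M t.
Proof.
move=> t0; rewrite /growth; congr (_ * _).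
have [ct|tc] := leP closing_time t.
  rewrite slow_density_after// g_1 mul1r slow_numberE// slow_rate_above//.
    by rewrite invfM invrK powRN invrK.
  by rewrite -Hle area_clock_slow -time_clock_closing Wle.
rewrite slow_rate_below ?slow_area_gt0//= ?slow_area_full_le ?ltW//.
by rewrite /slow_number ltW.
Qed.

Section Until.
Variable T : R.
Hypotheses (T0 : 0 <= T) (TTs : T <= Ts) (WT : W T <= H smax).

Let sub t : 0 <= t <= T -> 0 <= t <= Ts.
Proof. by case/andP=> t0 tT; rewrite t0 (le_trans tT). Qed.

Lemma slow_area_max t : t <= T -> slow_area t <= smax.
Proof. by move=> tT; rewrite slow_area_le (le_trans _ WT)// Wle. Qed.

Lemma slow_area_clamp t : 0 <= t <= T -> area_clamp M (slow_area t) = slow_area t.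
Proof.
by case/andP=> t0 tT; rewrite /area_clamp clamp_id// slow_area_ge// slow_area_max.
Qed.

Lemma is_derive_slow_area_growth t : 0 <= t <= T ->
  is_derive t (1 : R) slow_area (growth M slow_number slow_area t).
Proof.
move=> tT; have := is_derive_slow_area t.
by rewrite slow_area_clamp// clamp_id ?sub// slow_growth//; case/andP: tT.
Qed.

Lemma slow_e_rE t : 0 <= t <= T -> slow_e_r t = e_r M (slow_area t) t.
Proof. by move=> tT; rewrite /slow_e_r slow_area_clamp// clamp_id// sub. Qed.

Lemma slow_growth_continuous : {within `[0, T], continuous (growth M slow_number slow_area)}.
Proof.
have cc : {within `[0, T], continuous (fun t =>
    slow_rate M (area_clamp M (slow_area t)) * V M (clamp 0 Ts t))}.
  apply: continuous_subspaceT => t; apply: cvgM; last exact: V_clamp_continuous.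
  apply: (@continuous_comp _ _ _ slow_area (slow_rate M \o area_clamp M)).
    exact: slow_area_continuous.
  exact: slow_rate_continuous.
apply: subspace_eq_continuous cc => t; rewrite inE /= in_itv /= => tT.
by rewrite /from_subspace /= slow_area_clamp// clamp_id ?sub// slow_growth//; case/andP: tT.
Qed.

(** After [closing_time] the equations [n = s^(-q/2) / A] and
    [ds/dt = A s^(q/2) V] give [dn/dt = - (q/2) V / s]. *)
Lemma is_derive_slow_number t : closing_time <= t <= T ->
  is_derive t (1 : R) (fun t => (coefA M)^-1 * slow_area t `^ (- a)) (- slow_e_r t).
Proof.
case/andP=> ct tT; have t0 := le_trans (ltW closing_time_gt0) ct.
have s0 := slow_area_gt0 t0.
have d1 := is_derive_slow_area_growth (introT andP (conj t0 tT)).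
have d2 := is_derive1_comp (is_derive1_powR (- a) s0) d1.
have -> : - slow_e_r t = (coefA M)^-1 *:
    ((- a * slow_area t `^ (- a - 1)) * growth M slow_number slow_area t).
  rewrite slow_e_rE ?t0// slow_growth// slow_rate_above//; last first.
    by rewrite -Hle area_clock_slow -time_clock_closing Wle.
  rewrite /e_r /GRing.scale /= powRB; last by rewrite (gt_eqF s0) implybT.
  rewrite powRN powRr1; last exact: ltW.
  have p0 : slow_area t `^ a != 0 by rewrite gt_eqF// powR_gt0.
  have A0 : coefA M != 0 by rewrite gt_eqF// A_gt0.
  have s0' : slow_area t != 0 by rewrite gt_eqF.
  by field; rewrite p0 A0 s0'.
exact: is_deriveZ.
Qed.

Lemma slow_number_le t : 0 <= t <= T -> nmin M <= slow_number t.
Proof.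
case/andP=> t0 tT; have [ct|tc] := leP closing_time t; last first.
  by rewrite /slow_number (ltW tc) n0_ge.
rewrite leNgt; apply/negP => h.
have : density M (slow_number t) (slow_area t) < density M (nmin M) (slow_area t).
  rewrite /density ltr_pM2r ?powR_gt0 ?slow_area_gt0//.
  by rewrite ltr_pM2l// A_gt0.
rewrite slow_density_after// ltNge density_le1 ?nmin_pos ?slow_area_gt0//.
by rewrite slow_area_max.
Qed.

Hypothesis er_le : forall t, closing_time < t < T -> e_r M (slow_area t) t <= emax M.

(** Before [closing_time] nothing is cut. Afterwards the capped control
    coincides with [slow_e_r], except perhaps at the final time, which is why
    derivatives are only compared on the open interval. *)
Lemma slow_control_integral t : 0 <= t <= T ->
  slow_number t = n0 M - \int[mu]_(u in `[0, t]) slow_control u.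
Proof.
case/andP=> t0 tT; have c0 := closing_time_gt0.
have ccst : continuous (cst 0 : R -> R) by move=> x; exact: cvg_cst.
have left v : v <= closing_time -> \int[mu]_(u in `[0, v]) slow_control u = 0.
  move=> vc; rewrite integral_switch_left//; last exact: slow_rhs_continuous.
  by rewrite Rintegral_cst ?mul0r.
have [tc|ct] := leP t closing_time.
  by rewrite left// subr0 /slow_number tc.
have slow_int : mu.-integrable `[0, t] (EFin \o slow_control).
  by apply: integrable_switch => //; exact: slow_rhs_continuous.
rewrite (integral_split (ltW c0) (ltW ct) slow_int) left// add0r.
rewrite integral_switch_right//.
have [_ dP] := primitiveP closing_time slow_rhs_continuous.
rewrite (integral_derive (ltW ct) _ (fun x _ => dP x)); last first.
  by apply: continuous_subspaceT; exact: slow_rhs_continuous.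
have dd (x : R) : closing_time <= x <= t -> is_derive x 1
    (primitive closing_time (fun t => Num.min (emax M) (slow_e_r t))
     + (fun t => (coefA M)^-1 * slow_area t `^ (- a)))
    (Num.min (emax M) (slow_e_r x) - slow_e_r x).
  move=> /andP[cx xt]; apply: is_deriveD; apply: is_derive_slow_number.
  by rewrite cx (le_trans xt).
have := derive_0_eq (ltW ct) dd; rewrite !addrfctE => /(_ _) dP0.
have {dP0} := dP0 _; rewrite -!slow_numberE ?(ltW ct)// => dP0.
have -> : n0 M = slow_number closing_time by rewrite /slow_number lexx.
suff /dP0 : forall x : R, closing_time < x < t ->
  Num.min (emax M) (slow_e_r x) - slow_e_r x = 0 by lra.
move=> x /andP[cx xt]; have xT := lt_le_trans xt tT.
rewrite (min_idPr _) ?subrr// slow_e_rE ?er_le// ?cx//.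
by rewrite !ltW// (lt_trans c0).
Qed.

Lemma slow_solution : solution M T slow_control slow_area slow_number.
Proof.
have ccst : continuous (cst 0 : R -> R) by move=> x; exact: cvg_cst.
split.
- by apply: measurable_switch => //; exact: slow_rhs_continuous.
- by apply: integrable_switch => //; exact: slow_rhs_continuous.
- by apply: continuous_integrable; exact: slow_growth_continuous.
- move=> t; rewrite in_itv /= => /andP[t0 tT]; rewrite inE; apply: J01 => //.
  by rewrite slow_density_le1// density_ge0// ltW// slow_number_gt0.
- move=> t; rewrite in_itv /= => /andP[t0 tT].
  have cw : {within `[0, t], continuous (growth M slow_number slow_area)}.
    apply: continuous_subspaceW slow_growth_continuous.
    by apply: subset_itvl; rewrite bnd_simp.
  have dS (x : R) : 0 <= x <= t ->
      is_derive x 1 slow_area (growth M slow_number slow_area x).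
    move=> /andP[x0 xt]; apply: is_derive_slow_area_growth.
    by rewrite x0 (le_trans xt).
  by rewrite (integral_derive t0 cw dS) slow_area0; ring.
- by move=> t; rewrite in_itv /= => tT; exact: slow_control_integral.
Qed.

Lemma slow_control_range t : 0 <= t <= T -> 0 <= slow_control t <= emax M.
Proof.
case/andP=> t0 tT; have e0 := ltW (emax_gt0 HM).
rewrite /slow_control /switch; case: ifP => _; first by rewrite lexx.
rewrite le_min e0 ge_min lexx /= andbT /slow_e_r mulr_ge0 ?(ltW (a_gt0 HM))//.
by rewrite divr_ge0 ?ltW ?V_clamp_gt0 ?area_clamp_gt0.
Qed.

Lemma slow_admissible : admissible M T slow_control slow_area slow_number.
Proof.
split; first exact: slow_solution.
move=> t; rewrite in_itv /= => tT; split.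
- exact: slow_control_range.
- exact: slow_number_le.
- by apply: slow_density_le1; case/andP: tT.
Qed.

End Until.

Lemma adm_slow_area_le T (e s n : R -> R) : 0 <= T <= Ts ->
  admissible M T e s n -> slow_area T <= s T.
Proof.
case/andP=> T0 TTs adm; rewrite slow_area_le.
by apply: (adm_clock_le HM g_incr g_conc g_0 g_1 g_gt adm) => //; rewrite T0 lexx.
Qed.

Lemma adm_time_clock_le T (e s n : R -> R) : 0 <= T <= Ts ->
  admissible M T e s n -> W T <= H smax.
Proof.
case/andP=> T0 TTs adm; have TT : 0 <= T <= T by rewrite T0 lexx.
apply: (le_trans (adm_clock_le HM g_incr g_conc g_0 g_1 g_gt adm T0 TTs TT)).
by rewrite Hle (adm_s_le HM g_incr g_0 adm TTs TT).
Qed.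

(** E^0 realizes the minimal basal area [s_m(t)] as long as it is
    admissible. *)
Lemma slow_is_sm T : 0 <= T <= Ts ->
  admissible M T slow_control slow_area slow_number -> is_sm M T (slow_area T).
Proof.
move=> TTs adm; split; first by exists slow_control, slow_area, slow_number.
by move=> x [e [s [n [adm' <-]]]]; exact: adm_slow_area_le adm'.
Qed.

Hypothesis e_r_lt : forall t m : R, 0 < t < Ts -> is_sm M t m ->
  e_r M m t < emax M.

(** The hypothesis on [s_m] speaks of E^0 only while E^0 is admissible, and
    admissibility of E^0 needs the bound on its control. The circle is broken at
    the first time at which the bound fails: E^0 is still admissible up to that
    time, so that its basal area is [s_m] there and the hypothesis applies. *)
Lemma slow_e_r_lt t : closing_time <= t -> t < Ts -> W t <= H smax ->
  e_r M (slow_area t) t < emax M.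
Proof.
move=> ct tTs Wt; rewrite ltNge; apply/negP => bad.
have c0 := closing_time_gt0; have t0 := le_trans (ltW c0) ct.
have sub u : closing_time <= u <= t -> 0 <= u <= t.
  by case/andP=> cu ->; rewrite (le_trans (ltW c0)).
pose h u := emax M - slow_e_r u.
have ch : continuous h.
  by move=> u; apply: cvgB; [exact: cvg_cst|exact: slow_e_r_continuous].
have hE u : closing_time <= u <= t -> h u = emax M - e_r M (slow_area u) u.
  by move=> /sub ut; rewrite /h (slow_e_rE (ltW tTs) Wt).
have [|u [ut hu before]] := first_nonpos ch ct.
  by rewrite hE ?ct ?lexx// subr_le0.
have [cu u_t] := andP ut; have u0 := lt_le_trans c0 cu.
have uTs := le_lt_trans u_t tTs.
have Wu : W u <= H smax by rewrite (le_trans _ Wt)// Wle.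
have adm : admissible M u slow_control slow_area slow_number.
  apply: slow_admissible => //; first exact: ltW.
  move=> v /andP[cv vu]; have := before v; rewrite (ltW cv) vu => /(_ isT).
  by rewrite hE ?subr_gt0 => [/ltW//|]; rewrite (ltW cv) (le_trans (ltW vu)).
have um : is_sm M u (slow_area u) by apply: slow_is_sm => //; rewrite !ltW.
have u0Ts : 0 < u < Ts by rewrite u0.
have := e_r_lt u0Ts um; move: hu; rewrite hE// subr_le0 => hu.
by rewrite ltNge hu.
Qed.

Lemma slow_admissible_until T : 0 <= T <= Ts -> W T <= H smax ->
  admissible M T slow_control slow_area slow_number.
Proof.
case/andP=> T0 TTs WT; apply: slow_admissible => // t /andP[ct tT].
apply/ltW/slow_e_r_lt; [exact: ltW|exact: lt_le_trans TTs|].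
by rewrite (le_trans _ WT)// Wle ltW.
Qed.

(** The basal area is at least [s_m], and [e_r] decreases with the basal
    area. *)
Lemma adm_e_r_lt T (e s n : R -> R) : 0 < T < Ts -> admissible M T e s n ->
  e_r M (s T) T < emax M.
Proof.
case/andP=> T0 TTs adm; have TT : 0 <= T <= Ts by rewrite !ltW.
have slow := slow_admissible_until TT (adm_time_clock_le TT adm).
apply: le_lt_trans (e_r_lt _ (slow_is_sm TT slow)); last by rewrite T0.
rewrite /e_r ler_pM2l ?a_gt0// ler_pM2l; last first.
  by apply: (V_gt0 HM); rewrite in_itv /= !ltW.
have sT := adm_slow_area_le TT adm.
have s0 := slow_area_gt0 (ltW T0).
by rewrite lef_pV2 ?posrE// (lt_le_trans s0).
Qed.


Lemma same_number_same_control T (e s n e' s' n' : R -> R) :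
  solution M T e s n -> solution M T e' s' n' ->
  {in `[0, T], forall t, n' t = n t} ->
  {ae mu, forall t, t \in `[0, T] -> e' t = e t}.
Proof.
move=> sol sol' nn; apply: ae_eq_of_integrals.
- exact: control_integrable sol.
- exact: control_integrable sol'.
- move=> t tT; have tI : t \in `[0, T] by rewrite in_itv.
  by have := nn t tI; rewrite (n_eq sol tI) (n_eq sol' tI) => /addrI/oppr_inj.
Qed.

Lemma closing_time_le T : H sfull <= W T -> closing_time <= T.
Proof. by rewrite -time_clock_closing Wle. Qed.

Lemma sfull_le_smax : sfull <= smax.
Proof. by apply: full_area_le => //; rewrite nmin_pos ?n0_ge. Qed.

Lemma slow_reaches T : 0 <= T <= Ts -> W T = H smax ->
  reaches M T slow_control slow_area slow_number.
Proof.
move=> TTs WT; have [T0 _] := andP TTs.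
have adm : admissible M T slow_control slow_area slow_number.
  by apply: slow_admissible_until; rewrite ?WT.
have sT : slow_area T = smax.
  by have [_ K _ _ _] := clocks; rewrite /slow_area WT K.
have d1 : density M (slow_number T) (slow_area T) = 1.
  by apply: slow_density_after; apply: closing_time_le; rewrite WT Hle sfull_le_smax.
split=> //.
have p0 : smax `^ a != 0 by rewrite gt_eqF// powR_gt0// full_area_gt0// nmin_pos.
move: d1; rewrite sT -(density_full_area HM (nmin_pos HM)) /density.
by move=> /(mulIf p0)/mulfI; apply; rewrite gt_eqF// A_gt0.
Qed.

Lemma reaches_area T (e s n : R -> R) : 0 <= T <= Ts -> reaches M T e s n ->
  s T = smax.
Proof.
case/andP=> T0 TTs [adm d1 nT].
apply: density_eq1 => //; first exact: nmin_pos.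
  by apply: (adm_s_gt0 HM g_incr g_0 adm TTs); rewrite T0 lexx.
by rewrite -nT.
Qed.

(** A trajectory reaching the target at this time has its two clocks equal
    there, hence everywhere: it has the basal area of E^0. In the second phase
    the slowest rate is only attained for [g r = r], that is [r = 1], and the
    tree number is that of E^0. In the first phase [g r / r] may be constant, so
    the rate says nothing about [n]; but by continuity [n] equals [n(0)] at
    [closing_time], and it does not increase, so it was [n(0)] before. *)
Lemma slow_only T : 0 < T <= Ts -> W T = H smax ->
  only_trajectory_reaching M T slow_control slow_area slow_number.
Proof.
case/andP=> Tpos TTs WT; have T0 := ltW Tpos.
have T0Ts : 0 <= T <= Ts by rewrite T0.
have slow := slow_reaches T0Ts WT.
split=> // e s n reach; have [adm d1 nT] := reach.
have [sadm sd1 snT] := slow.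
have cT : closing_time <= T.
  by apply: closing_time_le; rewrite WT Hle sfull_le_smax.
have c0 := closing_time_gt0.
have [|sH rate] := adm_clock_eq HM g_incr g_conc g_0 g_1 g_gt adm T0 TTs.
  by rewrite WT (reaches_area T0Ts reach).
have sE t : 0 <= t <= T -> s t = slow_area t.
  move=> /sH; have [_ K _ _ _] := clocks.
  by rewrite /slow_area => <-; rewrite K.
have nE_after t : closing_time < t <= T -> n t = slow_number t.
  case/andP=> ct; rewrite le_eqVlt => /predU1P[->|tT]; first by rewrite nT snT.
  have t0 := lt_trans c0 ct; have tT' : 0 <= t <= T by rewrite !ltW.
  have t0T : 0 < t < T by rewrite t0.
  have s_gt0 := slow_area_gt0 (ltW t0).
  have n_gt0 := adm_n_gt0 HM adm tT'.
  have p0 : slow_area t `^ a != 0 by rewrite gt_eqF// powR_gt0.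
  have An0 : coefA M != 0 by rewrite gt_eqF// A_gt0.
  have d_gt0 := density_gt0 HM n_gt0 s_gt0.
  have := rate t t0T; rewrite sE// slow_rate_above//; last first.
    by rewrite -Hle area_clock_slow -time_clock_closing Wle ltW.
  move=> /(canRL (divfK _)); rewrite (gt_eqF n_gt0) => /(_ isT) gd.
  have : density M (n t) (slow_area t) = 1.
    apply: (g_fixpoint g_gt).
      by rewrite d_gt0 -sE// (adm_density adm).
    by rewrite gd /density; ring.
  rewrite -(slow_density_after (ltW ct)) /density => /(mulIf p0).
  by move=> /mulfI; apply.
have nE_closing : n closing_time = n0 M.
  have cTT : 0 <= closing_time <= T by rewrite ltW.
  apply/eqP; rewrite eq_le (adm_n_le adm)//= leNgt; apply/negP => lt.
  move: cT; rewrite le_eqVlt => /predU1P[cT|cT].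
    by move: lt; rewrite cT nT -snT -cT /slow_number lexx ltxx.
  (* By continuity [n] is close to [n(0)] just after [closing_time]: over a time
  [d] both tree numbers change by at most [emax * d], which is taken to be at
  most half of the supposed gap. *)
  pose d := Num.min (T - closing_time) ((n0 M - n closing_time) / (2 * emax M)).
  have e0 := emax_gt0 HM.
  have dpos : 0 < d.
    by rewrite lt_min subr_gt0 cT divr_gt0 ?subr_gt0// mulr_gt0.
  have dT : closing_time + d <= T by rewrite -lerBrDl ge_min lexx.
  have dn : emax M * d <= (n0 M - n closing_time) / 2.
    have : d <= (n0 M - n closing_time) / (2 * emax M) by rewrite ge_min lexx orbT.
    rewrite ler_pdivlMr ?mulr_gt0// => h; rewrite ler_pdivlMr//.
    by apply: le_trans h; rewrite le_eqVlt; apply/orP; left; apply/eqP; ring.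
  have cd : 0 <= closing_time <= closing_time + d by rewrite (ltW c0) lerDl ltW.
  have /andP[h1 _] := adm_n_step adm cd dT.
  have /andP[_ h2] := adm_n_step sadm cd dT.
  move: h1 h2; rewrite (nE_after (closing_time + d)) ?dT ?ltrDl ?dpos//.
  rewrite {2}/slow_number lexx addrAC subrr add0r; lra.
have nE t : 0 <= t <= T -> n t = slow_number t.
  case/andP=> t0 tT; have [tc|ct] := leP t closing_time; last first.
    by apply: nE_after; rewrite ct.
  have tc' : 0 <= t <= closing_time by rewrite t0.
  have /andP[h _] := adm_n_step adm tc' cT.
  rewrite /slow_number tc; apply/eqP; rewrite eq_le.
  rewrite (adm_n_le adm) ?t0//=.
  by move: h; rewrite nE_closing subr_ge0.
split; last by move=> t; rewrite in_itv /= => tT; rewrite sE ?nE.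
apply: same_number_same_control sadm.1 adm.1 _ => t.
by rewrite in_itv /= => /nE.
Qed.

Lemma slow_traj T : 0 <= T <= Ts -> T < Ts -> W T = H smax ->
  traj_E_sup0 M closing_time T slow_control slow_area slow_number.
Proof.
move=> T0Ts TTs WT; have [T0 _] := andP T0Ts.
have c0 := closing_time_gt0.
have cT : closing_time <= T.
  by apply: closing_time_le; rewrite WT Hle sfull_le_smax.
have [adm _ nT] := slow_reaches T0Ts WT.
have WT' : W T <= H smax by rewrite WT.
split=> //.
- by case: adm.
- by rewrite (ltW c0).
- by move=> t; rewrite in_itv /= => /slow_density_before.
- exact: slow_density_after.
- by move=> t; rewrite in_itv /= => /andP[_ tc]; rewrite /slow_control /switch tc.
- move=> t; rewrite in_itv /= => /andP[ct tT].
  have tT' : 0 <= t <= T by rewrite (ltW (lt_trans c0 ct)) ltW.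
  have tTs := lt_trans tT TTs.
  have Wt : W t <= H smax by rewrite (le_trans _ WT')// Wle ltW.
  rewrite /slow_control /switch ltNge (ltW ct) /= (slow_e_rE (ltW TTs) WT')//.
  by apply/min_idPr/ltW/slow_e_r_lt => //; exact: ltW.
- move=> t; rewrite in_itv /= => /andP[ct tT].
  have t0 := le_trans (ltW c0) ct.
  have s_gt0 := slow_area_gt0 t0.
  rewrite ltNge; apply/negP => h.
  have : slow_area t < smax by rewrite slow_area_lt -WT Wlt.
  rewrite ltNge => /negP; apply; rewrite leNgt; apply/negP => lt.
  have : density M (slow_number t) (slow_area t) < density M (nmin M) smax.
    apply: (@le_lt_trans _ _ (density M (nmin M) (slow_area t))).
      by apply: density_mono => //; rewrite ?h ?lexx ltW// slow_number_gt0.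
    rewrite /density ltr_pM2l ?mulr_gt0 ?A_gt0 ?nmin_pos//.
    by rewrite gt0_ltr_powR ?a_gt0// ?nnegrE ?ltW ?full_area_gt0 ?nmin_pos.
  by rewrite slow_density_after// density_full_area ?nmin_pos// ltxx.
Qed.

(** Beyond [full_area (n0 M)] the area clock has derivative [x^(-q/2) / A], and
    its increments are explicit. *)
Lemma area_clock_full n : nmin M <= n <= n0 M ->
  coefA M `^ (2 / expq M) * (1 - a) * (H (full_area M n) - H sfull) =
  n `^ (1 - 2 / expq M) - n0 M `^ (1 - 2 / expq M).
Proof.
case/andP=> nn nn0.
have n_gt0 := lt_le_trans (nmin_pos HM) nn.
have A0 := A_gt0 HM; have a0 := a_gt0 HM.
have a1 : 1 - a != 0 by have := a_range HM; lra.
have -> : 2 / expq M = a^-1 by rewrite invf_div.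
(* An explicit antiderivative of [x^(-q/2) / A]. *)
pose G x := (coefA M * (1 - a))^-1 * x `^ (1 - a).
have fle : sfull <= full_area M n by apply: full_area_le; rewrite ?n_gt0.
have fle' : full_area M n <= smax by apply: full_area_le; rewrite ?nmin_pos.
have f_gt0 := full_area_gt0 HM (n0_pos HM).
have [_ _ _ dH _] := clocks.
have dd (x : R) : sfull <= x <= full_area M n -> is_derive x 1 (H - G)
    ((slow_rate M (area_clamp M x))^-1 - (coefA M * (1 - a))^-1 *: ((1 - a) * x `^ (1 - a - 1))).
  case/andP=> fx xf; have dp := is_derive1_powR (1 - a) (lt_le_trans f_gt0 fx).
  have dG : is_derive x 1 G ((coefA M * (1 - a))^-1 *: ((1 - a) * x `^ (1 - a - 1))).
    exact: is_deriveZ.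
  exact: is_deriveB.
have lin (u v w z : R) : u - w = v - z -> v - u = z - w by lra.
have HG : H (full_area M n) - H sfull = G (full_area M n) - G sfull.
  apply: lin; apply: (derive_0_eq fle dd).
  move=> x /andP[fx xf]; have x0 := lt_trans f_gt0 fx.
  rewrite /area_clamp clamp_id; last first.
    rewrite (le_trans (ltW (s0_lt_full_area HM)) (ltW fx)).
    by rewrite (le_trans (ltW xf)).
  rewrite slow_rate_above// ?ltW// (_ : 1 - a - 1 = - a); last by ring.
  rewrite powRN /GRing.scale /=.
  have p0 : x `^ a != 0 by rewrite gt_eqF// powR_gt0.
  have cancel (b c p : R) : b != 0 -> c != 0 -> p != 0 ->
    (b * p)^-1 - (b * c)^-1 * (c * p^-1) = 0.
    by move=> b0 c0 p0'; field; rewrite b0 c0 p0'.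
  by apply: cancel => //; rewrite gt_eqF.
have GE m : 0 < m -> G (full_area M m) =
    (coefA M * (1 - a))^-1 * (coefA M `^ (1 - a^-1) * m `^ (1 - a^-1)).
  move=> m0; rewrite /G /full_area -powRrM -powRM ?ltW//; congr (_ * _ `^ _).
  by rewrite mulrBr mulr1 mulNr mulVf ?gt_eqF//; ring.
have AA : coefA M `^ a^-1 * coefA M `^ (1 - a^-1) = coefA M.
  rewrite -powRD; last by rewrite (gt_eqF A0) implybT.
  by rewrite addrC subrK powRr1// ltW.
rewrite HG !GE ?n0_pos//.
transitivity ((coefA M `^ a^-1 * coefA M `^ (1 - a^-1)) / coefA M *
   (n `^ (1 - a^-1) - n0 M `^ (1 - a^-1))).
  have factor (b c p p' u v : R) : b != 0 -> c != 0 ->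
    p * c * ((b * c)^-1 * (p' * u) - (b * c)^-1 * (p' * v)) = p * p' / b * (u - v).
    by move=> b0 c0; field; rewrite b0 c0.
  by apply: factor => //; rewrite gt_eqF.
by rewrite AA divff ?mul1r// gt_eqF.
Qed.

Lemma integral_V t u : 0 <= t <= u -> u <= Ts ->
  \int[mu]_(x in `[t, u]) V M x = W u - W t.
Proof.
case/andP=> t0 tu uTs; have [_ _ _ dW] := time_clockP HM.
have cV : {within `[t, u], continuous (V M \o clamp 0 Ts)}.
  by apply: continuous_subspaceT; exact: V_clamp_continuous.
rewrite -(integral_derive tu cV (fun x _ => dW x)).
apply: eq_Rintegral => x; rewrite inE /= in_itv /= => /andP[tx xu].
by rewrite clamp_id// (le_trans t0 tx) (le_trans xu uTs).
Qed.

(** If the time clock had not yet reached the value of the area clock at the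
    largest possible basal area, E^0 would remain admissible a little longer. *)
Lemma max_reach_time_clock Tmax : is_max (reach_times M) Tmax -> Tmax < Ts ->
  (forall T, Tmax < T <= Ts -> ~ exists e s n, admissible M T e s n) ->
  0 < Tmax /\ W Tmax = H smax.
Proof.
move=> [[/andP[T0 TTs] [e [s [n reach]]]] _] TltTs last; split=> //.
have T0Ts : 0 <= Tmax <= Ts by rewrite !ltW.
have [adm _ _] := reach.
apply/eqP; rewrite eq_le (adm_time_clock_le T0Ts adm) /= leNgt; apply/negP => lt.
have [_ _ K dW] := time_clockP HM.
(* The time at which E^0 would reach the target, if it is in the horizon. *)
pose T1 := Num.min Ts (inverse W (H smax)).
have TT1 : Tmax < T1.
  by rewrite lt_min TltTs ltNge -Wle K -ltNge.
have T1Ts : T1 <= Ts by rewrite ge_min lexx.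
apply: (last T1); first by rewrite TT1.
exists slow_control, slow_area, slow_number; apply: slow_admissible_until.
  by rewrite T1Ts (ltW (lt_trans T0 TT1)).
by rewrite -[leRHS]K Wle ge_min lexx orbT.
Qed.

Lemma maximal_time Tmax : is_max (reach_times M) Tmax -> Tmax < Ts ->
  (forall T, Tmax < T <= Ts -> ~ exists e s n, admissible M T e s n) ->
  exists t0 (e s n : R -> R),
    [/\ traj_E_sup0 M t0 Tmax e s n,
        only_trajectory_reaching M Tmax e s n &
        forall T, t0 <= T <= Ts ->
          (nmin M `^ (1 - 2 / expq M) - n0 M `^ (1 - 2 / expq M)
           = coefA M `^ (2 / expq M) * (1 - a)
             * \int[mu]_(u in `[t0, T]) V M u)
          <-> T = Tmax].
Proof.
move=> Tmx TltTs last; have [T0 WT] := max_reach_time_clock Tmx TltTs last.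
exists closing_time, slow_control, slow_area, slow_number; split.
- by apply: slow_traj => //; rewrite !ltW.
- by apply: slow_only => //; rewrite T0 ltW.
move=> T /andP[cT TTs].
rewrite integral_V ?(ltW closing_time_gt0) ?cT//.
rewrite -area_clock_full ?lexx ?n0_ge// time_clock_closing -WT.
have c0 : coefA M `^ (2 / expq M) * (1 - a) != 0.
  by rewrite mulf_neq0// ?gt_eqF ?powR_gt0 ?A_gt0//; have := a_range HM; lra.
split=> [/(mulfI c0)/addIr e|->//].
by apply/eqP; rewrite eq_le -[T <= Tmax]Wle -[Tmax <= T]Wle e !lexx.
Qed.

End Slow.

(** * Power laws, the trajectory E_0 and the minimal time *)

Section Fast.
Context {R : realType} (M : forest R) (HM : standing M).
Hypotheses (g_incr : {in J M &, {homo g M : x y / x <= y}})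
  (g_conc : concave_on (J M) (g M)) (g_0 : g M 0 = 0) (g_1 : g M 1 = 1)
  (g_gt : {in `]0, 1[, forall x, x < g M x})
  (e_r_lt : forall t m : R, 0 < t < Tstar M -> is_sm M t m ->
    e_r M m t < emax M).
Variable theta : R.
Hypotheses (theta01 : 0 < theta < 1) (JE : J M = `[0, +oo[%classic)
  (gE : {in J M, forall x, g M x = x `^ (1 - theta)}).
Notation mu := (@lebesgue_measure R).
Notation a := (expq M / 2).
Notation Ts := (Tstar M).
Notation smax := (full_area M (nmin M)).
Notation t0n := (t0_nmin M).
Implicit Types (x r t u T : R).

(** For a power law, [ds/dt = A^(1-theta) n^(-theta) s^(1-m) V] with [m] the
    exponent below, so that [s^m] is an explicit integral of [n^(-theta) V] for
    every trajectory. *)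
Definition area_exponent := 1 - a * (1 - theta).
Notation m := area_exponent.

(** The smallest tree number compatible with the bound on the control. *)
Definition fast_number t := Num.max (nmin M) (n0 M - emax M * t).
(** Up to a constant factor, the derivative of [s^m] along E_0. *)
Definition fast_drive t := fast_number t `^ (- theta) * V M (clamp 0 Ts t).
Definition fast_power t :=
  s0 M `^ m + m * coefA M `^ (1 - theta) * primitive 0 fast_drive t.
Definition fast_area t := fast_power t `^ m^-1.
Definition fast_control := switch t0n (cst (emax M)) (cst 0).

Let A0 := A_gt0 HM.

Lemma area_exponent_gt0 : 0 < m.
Proof.
rewrite /area_exponent subr_gt0; have /andP[_ a1] := a_range HM.
apply: lt_trans a1; rewrite gtr_pMr ?a_gt0//.
by case/andP: theta01; lra.
Qed.

Let m0 := area_exponent_gt0.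

Lemma fast_number_ge t : nmin M <= fast_number t.
Proof. by rewrite le_max lexx. Qed.

Lemma fast_number_gt0 t : 0 < fast_number t.
Proof. exact: lt_le_trans (nmin_pos HM) (fast_number_ge t). Qed.

Lemma fast_number_before t : t <= t0n -> fast_number t = n0 M - emax M * t.
Proof.
move=> tt; apply/max_idPr; move: tt; rewrite /t0_nmin ler_pdivlMr ?emax_gt0//.
by rewrite lerBrDr -lerBrDl mulrC.
Qed.

Lemma fast_number_after t : t0n <= t -> fast_number t = nmin M.
Proof.
move=> tt; apply/max_idPl; move: tt; rewrite /t0_nmin ler_pdivrMr ?emax_gt0//.
by rewrite lerBlDr -lerBlDl mulrC.
Qed.

Lemma t0n_ge0 : 0 <= t0n.
Proof. by rewrite divr_ge0 ?subr_ge0 ?n0_ge// ltW// emax_gt0. Qed.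

Lemma fast_number0 : fast_number 0 = n0 M.
Proof. by rewrite fast_number_before ?t0n_ge0// mulr0 subr0. Qed.

Lemma fast_number_continuous : continuous fast_number.
Proof.
move=> t; apply: (@continuous_max _ R (cst (nmin M)) (fun t => n0 M - emax M * t)).
  exact: cvg_cst.
apply: cvgB; first exact: cvg_cst.
by apply: cvgM; [exact: cvg_cst|exact: cvg_id].
Qed.

Lemma fast_drive_continuous : continuous fast_drive.
Proof.
have cp : continuous (fun t => fast_number t `^ (- theta)).
  move=> t; apply: (@continuous_comp _ _ _ fast_number (fun y => y `^ (- theta))).
    exact: fast_number_continuous.
  exact: (is_derive_continuous (is_derive1_powR _ (fast_number_gt0 t))).
move=> t; apply: cvgM; [exact: cp|exact: V_clamp_continuous].
Qed.

Lemma fast_drive_gt0 t : 0 < fast_drive t.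
Proof. by rewrite mulr_gt0 ?V_clamp_gt0// powR_gt0// fast_number_gt0. Qed.

Lemma is_derive_fast_power t : is_derive t (1 : R) fast_power
  (m * coefA M `^ (1 - theta) * fast_drive t).
Proof.
have [_ dP] := primitiveP 0 fast_drive_continuous.
have d1 : is_derive t (1 : R) (fun t => m * coefA M `^ (1 - theta) * primitive 0 fast_drive t)
  (m * coefA M `^ (1 - theta) *: fast_drive t) by exact: is_deriveZ.
rewrite -[X in is_derive _ _ _ X]add0r; exact: is_deriveD.
Qed.

Lemma fast_power0 : fast_power 0 = s0 M `^ m.
Proof.
have [P0 _] := primitiveP 0 fast_drive_continuous.
by rewrite /fast_power P0 mulr0 addr0.
Qed.

Lemma fast_power_ge t : 0 <= t -> s0 M `^ m <= fast_power t.
Proof.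
move=> t0; rewrite -fast_power0.
apply: (derive_ge0_le t0 (fun x _ => is_derive_fast_power x)) => x _.
apply: mulr_ge0; last exact: ltW (fast_drive_gt0 x).
by apply: mulr_ge0; [exact: ltW m0|exact: powR_ge0].
Qed.

Lemma fast_power_gt0 t : 0 <= t -> 0 < fast_power t.
Proof.
by move=> /fast_power_ge; apply: lt_le_trans; rewrite powR_gt0// s0_gt0.
Qed.

Lemma fast_area_gt0 t : 0 <= t -> 0 < fast_area t.
Proof. by move=> t0; rewrite powR_gt0// fast_power_gt0. Qed.

Lemma fast_area_power t : 0 <= t -> fast_area t `^ m = fast_power t.
Proof.
move=> t0; rewrite /fast_area -powRrM mulVf ?gt_eqF// powRr1//.
exact: ltW (fast_power_gt0 t0).
Qed.

Lemma fast_area0 : fast_area 0 = s0 M.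
Proof.
rewrite /fast_area fast_power0 -powRrM mulfV ?gt_eqF// powRr1// ltW//.
exact: s0_gt0.
Qed.

Lemma growth_power (n s : R -> R) t : 0 < n t -> 0 < s t ->
  growth M n s t =
    coefA M `^ (1 - theta) * n t `^ (- theta) * s t `^ (1 - m) * V M t.
Proof.
move=> n_gt0 s_gt0; rewrite /growth gE; last first.
  by rewrite JE inE /= in_itv /= andbT density_ge0// ltW.
rewrite /density !powRM ?mulr_ge0 ?powR_ge0 ?ltW// -powRrM.
rewrite /area_exponent subKr; congr (_ * _).
have -> : n t `^ (- theta) = n t `^ (1 - theta) / n t.
  rewrite powRN powRB; last by rewrite (gt_eqF n_gt0) implybT.
  by rewrite powRr1 ?ltW// mulrAC divff ?mul1r// gt_eqF.
ring.
Qed.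

Lemma is_derive_fast_area t : 0 <= t <= Ts ->
  is_derive t (1 : R) fast_area (growth M fast_number fast_area t).
Proof.
move=> tT; have [t0 _] := andP tT; have p0 := fast_power_gt0 t0.
rewrite growth_power ?fast_number_gt0 ?fast_area_gt0//.
have -> : coefA M `^ (1 - theta) * fast_number t `^ (- theta) *
    fast_area t `^ (1 - m) * V M t =
    (m^-1 * fast_power t `^ (m^-1 - 1)) *
    (m * coefA M `^ (1 - theta) * fast_drive t).
  rewrite /fast_drive clamp_id// /fast_area -powRrM mulrBr mulr1 mulVf ?gt_eqF//.
  by field; rewrite gt_eqF.
exact: is_derive1_comp (is_derive1_powR _ p0) (is_derive_fast_power t).
Qed.

Lemma fast_growth_continuous T : 0 <= T <= Ts ->
  {within `[0, T], continuous (growth M fast_number fast_area)}.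
Proof.
case/andP=> T0 TTs.
have cs : {within `[0, T], continuous fast_area}.
  apply: (@derive_within_continuous _ _ _ _ (growth M fast_number fast_area)) => x.
  by move=> /andP[x0 xT]; apply: is_derive_fast_area; rewrite x0 (le_trans xT).
have cc := continuous_comp_clamp T0 cs.
have cp : continuous (fun t => (fast_area \o clamp 0 T) t `^ (1 - m)).
  move=> t; apply: (@continuous_comp _ _ _ (fast_area \o clamp 0 T) (fun y => y `^ (1 - m))).
    exact: cc.
  apply: (is_derive_continuous (is_derive1_powR _ _)); apply: fast_area_gt0.
  by case/andP: (clamp_itv t T0).
have cg : {within `[0, T], continuous (fun t => coefA M `^ (1 - theta) *
    ((fast_area \o clamp 0 T) t `^ (1 - m) * fast_drive t))}.
  apply: continuous_subspaceT => t; apply: cvgM; first exact: cvg_cst.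
  by apply: cvgM; [exact: cp|exact: fast_drive_continuous].
apply: subspace_eq_continuous cg => t; rewrite inE /= in_itv /= => tT.
have [t0 tT'] := andP tT.
rewrite /from_subspace /= clamp_id// growth_power ?fast_number_gt0 ?fast_area_gt0//.
rewrite /fast_drive clamp_id ?t0 ?(le_trans tT')//; ring.
Qed.

Lemma fast_control_integral t : 0 <= t ->
  fast_number t = n0 M - \int[mu]_(u in `[0, t]) fast_control u.
Proof.
move=> t0.
have cc c : continuous (cst c : R -> R) by move=> x; exact: cvg_cst.
have left v : 0 <= v -> v <= t0n ->
    \int[mu]_(u in `[0, v]) fast_control u = emax M * v.
  move=> v0 vt; rewrite integral_switch_left//.
  have cw : {within `[0, v], continuous (cst (emax M) : R -> R)}.
    exact: continuous_subspaceT.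
  have dF (x : R) : 0 <= x <= v -> is_derive x 1 (fun x : R => emax M * x) (cst (emax M) x).
    by move=> _; apply: is_derive_eq; rewrite scaler1.
  by rewrite (integral_derive v0 cw dF) mulr0 subr0.
have [tt|tt] := leP t t0n; first by rewrite left// fast_number_before.
have ci : mu.-integrable `[0, t] (EFin \o fast_control).
  by apply: integrable_switch.
rewrite (integral_split t0n_ge0 (ltW tt) ci) left ?t0n_ge0//.
rewrite integral_switch_right// Rintegral_cst// mul0r addr0.
rewrite fast_number_after ?ltW// /t0_nmin mulrC divfK ?gt_eqF ?emax_gt0//.
by rewrite subKr.
Qed.

Lemma fast_solution T : 0 <= T <= Ts ->
  solution M T fast_control fast_area fast_number.
Proof.
move=> TT; have [T0 TTs] := andP TT.
have cc c : continuous (cst c : R -> R) by move=> x; exact: cvg_cst.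
split.
- by apply: measurable_switch.
- by apply: integrable_switch.
- by apply: continuous_integrable; exact: fast_growth_continuous.
- move=> t; rewrite in_itv /= => /andP[t0 tT]; rewrite JE inE /= in_itv /= andbT.
  by rewrite density_ge0// ltW// fast_number_gt0.
- move=> t; rewrite in_itv /= => /andP[t0 tT].
  have tTs : 0 <= t <= Ts by rewrite t0 (le_trans tT).
  have dS (x : R) : 0 <= x <= t ->
      is_derive x 1 fast_area (growth M fast_number fast_area x).
    move=> /andP[x0 xt]; apply: is_derive_fast_area.
    by rewrite x0 (le_trans xt)// (le_trans tT).
  rewrite (integral_derive t0 (fast_growth_continuous tTs) dS) fast_area0; ring.
- by move=> t; rewrite in_itv /= => /andP[t0 _]; exact: fast_control_integral.
Qed.

Lemma fast_admissible T : 0 <= T <= Ts ->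
  (forall t, 0 <= t <= T -> density M (fast_number t) (fast_area t) <= 1) ->
  admissible M T fast_control fast_area fast_number.
Proof.
move=> TT d1; split; first exact: fast_solution.
move=> t; rewrite in_itv /= => tT; split; [|exact: fast_number_ge|exact: d1].
have e0 := ltW (emax_gt0 HM).
by rewrite /fast_control /switch; case: ifP => _; rewrite /= ?e0 lexx.
Qed.

Section Compare.
Variables (T : R) (e s n : R -> R).
Hypotheses (adm : admissible M T e s n) (T0 : 0 <= T) (TTs : T <= Ts).

Lemma adm_fast_number_le t : 0 <= t <= T -> fast_number t <= n t.
Proof.
move=> tT; have [t0 tT'] := andP tT.
rewrite /fast_number ge_max (adm_nmin adm)//=.
have t00 : (0 : R) <= 0 <= t by rewrite lexx.
have /andP[_] := adm_n_step adm t00 tT'.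
by rewrite subr0 (adm_n0 adm T0) lerBlDr -lerBlDl.
Qed.

(** The derivative of the difference of the two [m]-th powers has the sign of
    the difference of the tree numbers. *)
Lemma fast_gap : exists2 K : R -> R,
  forall t, 0 <= t <= T -> K t = fast_power t - s t `^ m &
  forall t, 0 <= t <= T -> is_derive t 1 K
    (m * coefA M `^ (1 - theta) *
      ((fast_number t `^ (- theta) - n t `^ (- theta)) * V M t)).
Proof.
have [X Xs dX] := adm_smooth HM g_incr g_0 adm T0 TTs.
exists (fun t => fast_power t - X t `^ m); first by move=> t tT; rewrite Xs.
move=> t tT; have s_gt0 := adm_s_gt0 HM g_incr g_0 adm TTs tT.
have n_gt0 := adm_n_gt0 HM adm tT.
have X0 : 0 < X t by rewrite Xs.
have d1 := is_derive1_comp (is_derive1_powR m X0) (dX t tT).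
have d2 := is_derive_fast_power t.
apply: (is_derive_eq (is_deriveB d2 d1)).
rewrite growth_power// Xs// /fast_drive clamp_id; last first.
  by case/andP: tT => -> tT; rewrite (le_trans tT).
have ss : s t `^ (m - 1) * s t `^ (1 - m) = 1.
  rewrite -powRD ?(gt_eqF s_gt0) ?implybT//.
  by rewrite (_ : _ + _ = 0) ?powRr0//; ring.
transitivity (m * coefA M `^ (1 - theta) * (fast_number t `^ (- theta) * V M t) -
  m * coefA M `^ (1 - theta) * n t `^ (- theta) * V M t *
    (s t `^ (m - 1) * s t `^ (1 - m))); first by ring.
by rewrite ss; ring.
Qed.

Let gap_ge0 t : 0 <= t <= T -> 0 <= m * coefA M `^ (1 - theta) *
      ((fast_number t `^ (- theta) - n t `^ (- theta)) * V M t).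
Proof.
move=> tT; rewrite mulr_ge0 ?mulr_ge0 ?powR_ge0 ?(ltW m0)//; last first.
  rewrite ltW// (V_gt0 HM)// in_itv /=.
  by case/andP: tT => -> tT; rewrite (le_trans tT).
rewrite subr_ge0 !powRN lef_pV2 ?posrE ?powR_gt0 ?fast_number_gt0 ?(adm_n_gt0 HM adm)//.
have f_ge0 := ltW (fast_number_gt0 t); have n_ge0 := ltW (adm_n_gt0 HM adm tT).
by apply: ge0_ler_powR; rewrite ?nnegrE// ?adm_fast_number_le//; case/andP: theta01 => /ltW.
Qed.

Let gap0 : fast_power 0 - s 0 `^ m = 0.
Proof. by rewrite (adm_s0 adm T0) fast_power0 subrr. Qed.

Lemma adm_le_fast_area t : 0 <= t <= T -> s t <= fast_area t.
Proof.
move=> tT; have [t0 tT'] := andP tT; have [K KE dK] := fast_gap.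
have s_gt0 := adm_s_gt0 HM g_incr g_0 adm TTs tT.
have : 0 <= K t.
  rewrite -gap0 -KE ?lexx//.
  apply: (derive_ge0_le t0 (df := fun t => m * coefA M `^ (1 - theta) *
      ((fast_number t `^ (- theta) - n t `^ (- theta)) * V M t))).
    by move=> x /andP[x0 xt]; apply: dK; rewrite x0 (le_trans xt).
  by move=> x /andP[x0 xt]; apply: gap_ge0; rewrite !ltW// (lt_le_trans xt).
rewrite KE// subr_ge0 => h; rewrite leNgt; apply/negP => lt.
move: h; rewrite leNgt => /negP; apply; rewrite -(fast_area_power t0).
by apply: gt0_ltr_powR; rewrite // nnegrE ltW// fast_area_gt0.
Qed.

(** Equal basal areas at the final time force the derivative in [fast_gap] to
    vanish inside the interval. *)
Lemma adm_fast_unique : s T = fast_area T -> n T = fast_number T ->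
  forall t, 0 <= t <= T -> s t = fast_area t /\ n t = fast_number t.
Proof.
move=> sT nT; have [K KE dK] := fast_gap.
have K0T : K 0 = K T.
  by rewrite !KE ?lexx ?T0// gap0 sT fast_area_power// subrr.
have [|c1 c2] := derive_ge0_const K0T dK.
  by move=> x /andP[x0 xT]; apply: gap_ge0; rewrite !ltW.
move=> t tT; have [t0 tT'] := andP tT; split.
  have := c1 t tT; rewrite !KE ?lexx// gap0 -fast_area_power//.
  move=> /subr0_eq/(powR_injective m0) ->//; rewrite nnegrE ltW ?fast_area_gt0//.
  exact: (adm_s_gt0 HM g_incr g_0 adm).
move: t0; rewrite le_eqVlt => /predU1P[<-|t0].
  by rewrite (adm_n0 adm) ?fast_number0.
move: tT'; rewrite le_eqVlt => /predU1P[->//|tT'].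
have t0T : 0 < t < T by rewrite t0.
have V0 : V M t != 0.
  by rewrite gt_eqF// (V_gt0 HM)// in_itv /= ltW//= ltW// (lt_le_trans tT').
have := c2 t t0T => /eqP; rewrite !mulf_eq0 (negbTE V0) (gt_eqF m0) /=.
rewrite (gt_eqF (powR_gt0 _ A0)) /= orbF subr_eq0 !powRN => /eqP/invr_inj.
have /andP[th0 _] := theta01.
move=> /(powR_injective th0) ->//; rewrite nnegrE ltW ?fast_number_gt0//.
exact: (adm_n_gt0 HM adm).
Qed.

End Compare.

(** When some trajectory reaches the target, E_0 has already cut all the trees
    it may cut, and its basal area is at least as large: its density index is
    at least 1. *)
Lemma reaches_fast T (e s n : R -> R) : 0 <= T <= Ts -> reaches M T e s n ->
  [/\ t0n <= T, fast_number T = nmin M &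
      1 <= density M (fast_number T) (fast_area T)].
Proof.
case/andP=> T0 TTs [adm d1 nT]; have TT : 0 <= T <= T by rewrite T0 lexx.
have fT : fast_number T = nmin M.
  apply/eqP; rewrite eq_le fast_number_ge andbT -nT.
  exact: (adm_fast_number_le adm).
split => //; last first.
  rewrite -d1 nT fT; apply: density_mono => //.
    by rewrite lexx ltW// nmin_pos.
  rewrite (adm_le_fast_area adm)// ltW//.
  exact: (adm_s_gt0 HM g_incr g_0 adm).
move: fT; rewrite /t0_nmin ler_pdivrMr ?emax_gt0// lerBlDr -lerBlDl mulrC.
by rewrite /fast_number => <-; rewrite le_max lexx orbT.
Qed.

(** The density index of E_0 cannot reach 1 while cutting at full rate: at that
    instant its derivative would be a positive multiple of [e_r - emax], which is
    negative. *)
Lemma fast_turning_point T : 0 < T < Ts -> T < t0n ->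
  admissible M T fast_control fast_area fast_number ->
  density M (fast_number T) (fast_area T) = 1 ->
  ~ (forall u, 0 <= u < T -> density M (fast_number u) (fast_area u) < 1).
Proof.
move=> TT Tt adm d1 before; have [T0 TTs] := andP TT.
have er := adm_e_r_lt HM g_incr g_conc g_0 g_1 g_gt e_r_lt TT adm.
have T0Ts : 0 <= T <= Ts by rewrite !ltW.
have s_gt0 := fast_area_gt0 (ltW T0).
(* In the cutting phase the density index is this smooth function of time. *)
pose f t := coefA M * (n0 M - emax M * t) * fast_area t `^ a.
have fE t : t <= t0n -> f t = density M (fast_number t) (fast_area t).
  by move=> tt; rewrite /f /density fast_number_before.
have dn : is_derive T (1 : R) (fun t : R => coefA M * (n0 M - emax M * t)) (coefA M * - emax M).
  have h1 : is_derive T (1 : R) (fun t : R => emax M * t) (emax M).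
    by apply: is_derive_eq; rewrite scaler1.
  have h2 : is_derive T (1 : R) (fun t : R => n0 M - emax M * t) (0 - emax M).
    exact: is_deriveB.
  by rewrite -sub0r; exact: is_deriveZ.
have ds := is_derive1_comp (is_derive1_powR a s_gt0) (is_derive_fast_area T0Ts).
have df : is_derive T (1 : R) f _ := is_deriveM dn ds.
have f_left u : 0 <= u < T -> f u <= f T.
  move=> uT; rewrite !fE ?d1 ?(ltW Tt)//; first exact: ltW (before u uT).
  by case/andP: uT => _ uT; rewrite ltW// (lt_trans uT).
have := derive_left_max df T0 f_left; rewrite leNgt => /negP; apply.
have nT := fast_number_gt0 T; rewrite (fast_number_before (ltW Tt)) in nT.
rewrite /growth d1 g_1 (fast_number_before (ltW Tt)).
have p0 : 0 < fast_area T `^ a by rewrite powR_gt0.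
have pm : fast_area T `^ (a - 1) = fast_area T `^ a / fast_area T.
  by rewrite powRB ?powRr1 ?ltW// (gt_eqF s_gt0) implybT.
have eq : forall (A N p q S v E : R), N != 0 -> S != 0 ->
    (A * N) *: (q * (p / S) * (1 / N * v)) + p *: (A * - E) =
    A * p * (q * (v / S) - E).
  by move=> A N p q S v E N0 S0; rewrite /GRing.scale /=; field; rewrite N0 S0.
rewrite pm eq ?gt_eqF// pmulr_rlt0 ?mulr_gt0// subr_lt0.
exact: er.
Qed.

(** The minimal time is the first time at which the density index of E_0 is
    1. By [fast_turning_point] it does not fall in the cutting phase. *)
Lemma minimal_time : reach_times M !=set0 ->
  exists Tmin (e s n : R -> R),
    [/\ is_min (reach_times M) Tmin, traj_E_sub0 M Tmin e s n &
        only_trajectory_reaching M Tmin e s n].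
Proof.
move=> [T1 [/andP[T1pos T1Ts] [e1 [s1 [n1 reach1]]]]].
have Ts0 : 0 <= Ts := ltW (Tstar_gt0 HM).
pose h t := 1 - density M (fast_number t) (fast_area (clamp 0 Ts t)).
have ch : continuous h.
  have cfa : continuous (fun t => fast_area (clamp 0 Ts t)).
    apply: (@continuous_comp_clamp _ 0 Ts fast_area Ts0).
    exact: derive_within_continuous is_derive_fast_area.
  have cd : continuous (fun t => density M (fast_number t) (fast_area (clamp 0 Ts t))).
    apply: (density_continuous fast_number_continuous cfa) => t.
    by apply: fast_area_gt0; case/andP: (clamp_itv t Ts0).
  by move=> t; apply: cvgB; [exact: cvg_cst|exact: cd].
have hE t : 0 <= t <= Ts -> h t = 1 - density M (fast_number t) (fast_area t).
  by move=> tT; rewrite /h clamp_id.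
have h0 : 0 < h 0.
  rewrite hE ?lexx// fast_number0 fast_area0 subr_gt0.
  exact: density0_lt1 HM.
have h_reach T e s n : 0 <= T <= Ts -> reaches M T e s n -> h T <= 0.
  move=> TT reach; have [_ _ d1] := reaches_fast TT reach.
  by rewrite hE// subr_le0.
have T1Ts' : 0 <= T1 <= Ts by rewrite ltW.
have [Tm [/andP[Tm0 TmT1] hTm before]] :=
  first_zero ch (ltW T1pos) h0 (h_reach _ _ _ _ T1Ts' reach1).
have TmTs := le_trans TmT1 T1Ts.
have TmTs' : 0 <= Tm <= Ts by rewrite ltW.
have dTm : density M (fast_number Tm) (fast_area Tm) = 1.
  by move: hTm; rewrite hE// => /subr0_eq.
have dlt t : 0 <= t < Tm -> density M (fast_number t) (fast_area t) < 1.
  move=> tT; have := before t tT; rewrite hE ?subr_gt0//.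
  by case/andP: tT => -> tT; rewrite (le_trans (ltW tT)).
have adm : admissible M Tm fast_control fast_area fast_number.
  apply: fast_admissible => // t /andP[t0].
  rewrite le_eqVlt => /predU1P[->|tT]; first by rewrite dTm.
  by rewrite ltW// dlt// t0.
have t0Tm : t0n <= Tm.
  rewrite leNgt; apply/negP => lt.
  have [t0T1 _ _] := reaches_fast T1Ts' reach1.
  have TT : 0 < Tm < Ts by rewrite Tm0 (lt_le_trans lt)// (le_trans t0T1).
  exact: (fast_turning_point TT lt adm dTm dlt).
have reach : reaches M Tm fast_control fast_area fast_number.
  by split=> //; exact: fast_number_after.
exists Tm, fast_control, fast_area, fast_number; split.
- split.
    split; first by rewrite Tm0.
    by exists fast_control, fast_area, fast_number.
  move=> T [/andP[T0 TTs] [e [s [n reachT]]]]; rewrite leNgt; apply/negP => lt.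
  have T0Ts : 0 <= T <= Ts by rewrite ltW.
  have := before T; rewrite ltW// lt => /(_ isT).
  by rewrite ltNge (h_reach _ _ _ _ T0Ts reachT).
- split; first by case: adm.
    by move=> t _ tt; rewrite /fast_control /switch tt.
  by move=> t _ tt; rewrite /fast_control /switch ltNge (ltW tt).
split=> // e s n reachT; have [admT d1 nT] := reachT.
have sT : s Tm = fast_area Tm.
  rewrite (reaches_area HM g_incr g_0 TmTs' reachT).
  apply/esym/density_eq1 => //; first exact: nmin_pos.
    exact: fast_area_gt0 (ltW Tm0).
  by rewrite -dTm fast_number_after.
have nT' : n Tm = fast_number Tm by rewrite nT fast_number_after.
have uniq := adm_fast_unique admT (ltW Tm0) TmTs sT nT'.
split; last by move=> t; rewrite in_itv /= => /uniq.
apply: same_number_same_control adm.1 admT.1 _ => t.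
by rewrite in_itv /= => /uniq[].
Qed.

End Fast.

(** * Extremal times *)

Unset Implicit Arguments.

Theorem corollary3p1 (R : realType) (M : forest R) (HM : standing M)
  (g_incr : {in J M &, {homo g M : x y / x <= y}})
  (g_conc : concave_on (J M) (g M))
  (g_0 : g M 0 = 0) (g_1 : g M 1 = 1)
  (g_gt : {in `]0, 1[, forall x, x < g M x})
  (e_r_lt : forall t m : R, 0 < t < Tstar M -> is_sm M t m ->
    e_r M m t < emax M) :
  (forall theta : R, 0 < theta < 1 ->
     J M = `[0, +oo[%classic -> {in J M, forall x, g M x = x `^ (1 - theta)} ->
     reach_times M !=set0 ->
     exists Tmin (e s n : R -> R),
       [/\ is_min (reach_times M) Tmin,
           traj_E_sub0 M Tmin e s n &
           only_trajectory_reaching M Tmin e s n])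
  /\
  (forall Tmax : R, is_max (reach_times M) Tmax -> Tmax < Tstar M ->
     (forall T, Tmax < T <= Tstar M -> ~ exists e s n, admissible M T e s n) ->
     exists t0 (e s n : R -> R),
       [/\ traj_E_sup0 M t0 Tmax e s n,
           only_trajectory_reaching M Tmax e s n &
           forall T, t0 <= T <= Tstar M ->
             (nmin M `^ (1 - 2 / expq M) - n0 M `^ (1 - 2 / expq M)
              = coefA M `^ (2 / expq M) * (1 - expq M / 2)
                * \int[lebesgue_measure]_(u in `[t0, T]) V M u)
             <-> T = Tmax]).
Proof.
split=> [theta theta01 JE gE|Tmax Tmx TltTs last].
  exact: (minimal_time HM g_incr g_conc g_0 g_1 g_gt e_r_lt theta01 JE gE).
exact: (maximal_time HM g_incr g_conc g_0 g_1 g_gt e_r_lt Tmx TltTs last).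
Qed.
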